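(* Let $\mathcal B$ be a bigroupoid and let $(\mathcal P,\pi,\Lambda,A,X)$ be a right $\mathcal B$-2-torsor over a set $X$. Let $P_\bullet=N_2(\mathcal P\triangleleft\mathcal B)$ and $\Lambda_\bullet=N_2(\Lambda)\colon P_\bullet\to N_2(\mathcal B)$. Then $\Lambda_\bullet$ is a Duskin–Glenn 2-torsor over $X$, namely: (a) $\Lambda_\bullet$ is an exact fibration in every dimension $n\ge2$; (b) $P_\bullet$ is augmented over $X$ via $\pi\colon P_0\to X$, i.e. $\pi\, d_0=\pi\, d_1$ on $P_1$; (c) the augmented simplicial set $P_\bullet\to X$ is aspherical, i.e. $\pi\colon P_0\to X$ is surjective and the boundary maps $P_1\to P_0\times_X P_0$ and $P_n\to K_n(P_\bullet)$ ($n\ge2$) are surjective; (d) $P_\bullet$ is 1-coskeletal, i.e. the boundary map $\delta_n\colon P_n\to K_n(P_\bullet)$ is a bijection for every $n\ge2$ (equivalently $P_\bullet\cong\mathrm{Cosk}^1(P_\bullet)$).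
   Context: A bigroupoid is a bicategory in which every 2-cell is invertible and every 1-cell is an equivalence. Let $\mathcal B$ be a bicategory with set of objects $B_0$, horizontal composition $\circ$, identity 1-cells $i_x$, associator $\alpha_{h,g,f}\colon(h\circ g)\circ f\Rightarrow h\circ(g\circ f)$, and unitors $\lambda_f\colon i_y\circ f\Rightarrow f$, $\rho_f\colon f\circ i_x\Rightarrow f$ for $f\colon x\to y$. Let $\mathcal B_1$ be the category whose objects are the 1-cells and whose morphisms are the 2-cells of $\mathcal B$ (under vertical composition), with source and target functors $D_1,D_0\colon\mathcal B_1\to B_0$ ($B_0$ viewed as a discrete category). In any category, composition of morphisms is written by juxtaposition. A right action of $\mathcal B$ on a category $\mathcal C$ consists of: a functor $\Lambda\colon\mathcal C\to B_0$ (the momentum); a functor $A\colon\mathcal C\times_{B_0}\mathcal B_1\to\mathcal C$, written $(p,f)\mapsto p\triangleleft f$ and $(a,\phi)\mapsto a\triangleleft\phi$, defined on pairs with $\Lambda(p)=D_0(f)$ (the target of $f$), such that $\Lambda(p\triangleleft f)=D_1(f)$ (the source of $f$); a natural isomorphism with components $\kappa_{p,f,g}\colon(p\triangleleft f)\triangleleft g\to p\triangleleft(f\circ g)$ (whenever $p\triangleleft f$ and $f\circ g$ are defined); and a natural isomorphism with components $\iota_p\colon p\triangleleft i_{\Lambda(p)}\to p$; such that (i) $(p\triangleleft\alpha_{f,g,h})\,\kappa_{p,f\circ g,h}\,(\kappa_{p,f,g}\triangleleft h)=\kappa_{p,f,g\circ h}\,\kappa_{p\triangleleft f,g,h}$ for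 all composable $p,f,g,h$; (ii) $(p\triangleleft\lambda_f)\,\kappa_{p,i_{\Lambda(p)},f}=\iota_p\triangleleft f$; (iii) $(p\triangleleft\rho_f)\,\kappa_{p,f,i_x}=\iota_{p\triangleleft f}$ where $x$ is the source of $f$. The action bicategory $\mathcal P\triangleleft\mathcal B$ of a right action on $\mathcal P$ has: objects the objects of $\mathcal P$; 1-cells $q\to p$ the pairs $(\psi,h)$ with $h\colon\Lambda(q)\to\Lambda(p)$ a 1-cell of $\mathcal B$ and $\psi\colon q\to p\triangleleft h$ in $\mathcal P$; 2-cells $\gamma\colon(\psi,h)\Rightarrow(\xi,l)$ the 2-cells $\gamma\colon h\Rightarrow l$ of $\mathcal B$ with $(p\triangleleft\gamma)\psi=\xi$; vertical composition and horizontal composition of 2-cells as in $\mathcal B$; composite of 1-cells $(\psi,h)\circ(\phi,g)=(\kappa_{p,h,g}(\psi\triangleleft g)\phi,\ h\circ g)$; identity 1-cell $(\iota_p^{-1},i_{\Lambda(p)})$; associator $\alpha_{h,g,f}$ and unitors $\lambda_h,\rho_h$ taken from $\mathcal B$. The canonical projection $\Lambda\colon\mathcal P\triangleleft\mathcal B\to\mathcal B$ is $p\mapsto\Lambda(p)$, $(\psi,h)\mapsto h$, $\gamma\mapsto\gamma$. A right $\mathcal B$-2-torsor over a set $X$ is a groupoid $\mathcal P$ with object set $P_0$, a functor $\pi\colon\mathcal P\to X$ ($X$ viewed as a discrete category), and a right action $(\Lambda,A,\kappa,\iota)$ of $\mathcal B$ on $\mathcal P$ which is fiberwise ($\pi(p\triangleleft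 f)=\pi(p)$ for all $(p,f)$ and $\pi(a\triangleleft\phi)=\pi(a)$), such that $\pi\colon P_0\to X$ is surjective, $\Lambda\colon P_0\to B_0$ is surjective, and the functor $(\mathrm{Pr}_1,A)\colon\mathcal P\times_{B_0}\mathcal B_1\to\mathcal P\times_X\mathcal P$, $(p,f)\mapsto(p,p\triangleleft f)$, $(a,\phi)\mapsto(a,a\triangleleft\phi)$, is an equivalence of groupoids (commuting with the first projections to $\mathcal P$). The Duskin nerve $N_2(\mathcal C)$ of a bicategory $\mathcal C$ is the simplicial set with $N_2(\mathcal C)_n$ the set of normal (strictly unital) homomorphisms from $[n]$, regarded as a locally discrete 2-category, to $\mathcal C$, with simplicial operators given by precomposition; a strict homomorphism acts by postcomposition. For a simplicial set $Y_\bullet$: $K_n(Y_\bullet)=\{(y_0,\dots,y_n)\in Y_{n-1}^{n+1}\mid d_iy_j=d_{j-1}y_i,\ i<j\}$ with boundary map $\delta_n(y)=(d_0y,\dots,d_ny)$; $\bigwedge^k_n(Y_\bullet)$ is the analogous set of tuples with the $k$-th entry omitted and conditions only for $i,j\neq k$, with horn map $p^k_n$; a simplicial map $f_\bullet\colon E_\bullet\to Y_\bullet$ is an exact fibration in dimension $n$ if for every $0\le k\le n$ the map $E_n\to\bigwedge^k_n(E_\bullet)\times_{\bigwedge^k_n(Y_\bullet)}Y_n$ induced by $p^k_n$ and $f_n$ is a bijection. *)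

(* Defs.v *)
(* All category-theoretic
   notions are defined from scratch below, in "essentially algebraic" form:
   cells of each dimension form a type, with source/target maps, and the
   composition operations are total functions whose values are only
   constrained (by the axioms) on composable arguments. *)
From mathcomp Require Import all_boot.
Set Implicit Arguments. Unset Strict Implicit. Unset Printing Implicit Defensive.

(* Data of a bicategory B: objects B0, 1-cells, 2-cells.
   bcomp1 g f = g o f ; bvcomp b a = b a (vertical composite, "b after a");
   bhcomp b a = b o a (horizontal composite);
   bassoc h g f : (h o g) o f => h o (g o f);
   blunit f : i_y o f => f ; brunit f : f o i_x => f. *)
Record Bicat := {
  bOb : Type; b1 : Type; b2 : Type;
  bsrc : b1 -> bOb; btgt : b1 -> bOb;
  bdom : b2 -> b1; bcod : b2 -> b1;
  bid1 : bOb -> b1; bcomp1 : b1 -> b1 -> b1;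
  bid2 : b1 -> b2; bvcomp : b2 -> b2 -> b2; bhcomp : b2 -> b2 -> b2;
  bassoc : b1 -> b1 -> b1 -> b2; blunit : b1 -> b2; brunit : b1 -> b2 }.

Definition is_iso2 (B : Bicat) (a : b2 B) : Prop :=
  exists b, bdom b = bcod a /\ bcod b = bdom a /\
    bvcomp b a = bid2 (bdom a) /\ bvcomp a b = bid2 (bcod a).

Definition IsBicat (B : Bicat) : Prop :=
  (forall x : bOb B, bsrc (bid1 x) = x /\ btgt (bid1 x) = x)
  /\ (forall g f : b1 B, bsrc g = btgt f ->
        bsrc (bcomp1 g f) = bsrc f /\ btgt (bcomp1 g f) = btgt g)
  /\ (forall a : b2 B, bsrc (bdom a) = bsrc (bcod a) /\ btgt (bdom a) = btgt (bcod a))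
  /\ (forall f : b1 B, bdom (bid2 f) = f /\ bcod (bid2 f) = f)
  /\ (forall b a : b2 B, bcod a = bdom b ->
        bdom (bvcomp b a) = bdom a /\ bcod (bvcomp b a) = bcod b)
  /\ (forall b a : b2 B, bsrc (bdom b) = btgt (bdom a) ->
        bdom (bhcomp b a) = bcomp1 (bdom b) (bdom a) /\
        bcod (bhcomp b a) = bcomp1 (bcod b) (bcod a))
  /\ (forall h g f : b1 B, bsrc h = btgt g -> bsrc g = btgt f ->
        bdom (bassoc h g f) = bcomp1 (bcomp1 h g) f /\
        bcod (bassoc h g f) = bcomp1 h (bcomp1 g f))
  /\ (forall f : b1 B, bdom (blunit f) = bcomp1 (bid1 (btgt f)) f /\ bcod (blunit f) = f)
  /\ (forall f : b1 B, bdom (brunit f) = bcomp1 f (bid1 (bsrc f)) /\ bcod (brunit f) = f)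
  /\ (forall a : b2 B, bvcomp a (bid2 (bdom a)) = a /\ bvcomp (bid2 (bcod a)) a = a)
  /\ (forall c b a : b2 B, bcod a = bdom b -> bcod b = bdom c ->
        bvcomp c (bvcomp b a) = bvcomp (bvcomp c b) a)
  /\ (forall g f : b1 B, bsrc g = btgt f -> bhcomp (bid2 g) (bid2 f) = bid2 (bcomp1 g f))
  /\ (forall b' b a' a : b2 B, bcod a = bdom a' -> bcod b = bdom b' ->
        bsrc (bdom b) = btgt (bdom a) ->
        bhcomp (bvcomp b' b) (bvcomp a' a) = bvcomp (bhcomp b' a') (bhcomp b a))
  /\ (forall c b a : b2 B, bsrc (bdom c) = btgt (bdom b) -> bsrc (bdom b) = btgt (bdom a) ->
        bvcomp (bassoc (bcod c) (bcod b) (bcod a)) (bhcomp (bhcomp c b) a)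
        = bvcomp (bhcomp c (bhcomp b a)) (bassoc (bdom c) (bdom b) (bdom a)))
  /\ (forall a : b2 B, bvcomp (blunit (bcod a)) (bhcomp (bid2 (bid1 (btgt (bdom a)))) a)
                = bvcomp a (blunit (bdom a)))
  /\ (forall a : b2 B, bvcomp (brunit (bcod a)) (bhcomp a (bid2 (bid1 (bsrc (bdom a)))))
                = bvcomp a (brunit (bdom a)))
  /\ (forall h g f : b1 B, bsrc h = btgt g -> bsrc g = btgt f -> is_iso2 (bassoc h g f))
  /\ (forall f : b1 B, is_iso2 (blunit f) /\ is_iso2 (brunit f))
  /\ (forall k h g f : b1 B, bsrc k = btgt h -> bsrc h = btgt g -> bsrc g = btgt f ->
        bvcomp (bassoc k h (bcomp1 g f)) (bassoc (bcomp1 k h) g f)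
        = bvcomp (bhcomp (bid2 k) (bassoc h g f))
            (bvcomp (bassoc k (bcomp1 h g) f) (bhcomp (bassoc k h g) (bid2 f))))
  /\ (forall g f : b1 B, bsrc g = btgt f ->
        bvcomp (bhcomp (bid2 g) (blunit f)) (bassoc g (bid1 (btgt f)) f)
        = bhcomp (brunit g) (bid2 f)).

Definition IsBigroupoid (B : Bicat) : Prop :=
  IsBicat B
  /\ (forall a : b2 B, is_iso2 a)
  /\ (forall f : b1 B, exists g, bsrc g = btgt f /\ btgt g = bsrc f /\
        (exists u, bdom u = bcomp1 g f /\ bcod u = bid1 (bsrc f) /\ is_iso2 u) /\
        (exists v, bdom v = bcomp1 f g /\ bcod v = bid1 (btgt f) /\ is_iso2 v)).

(* gcomp b a = b a ("b after a"). *)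
Record Groupoid := {
  gOb : Type; gMor : Type;
  gdom : gMor -> gOb; gcod : gMor -> gOb;
  gid : gOb -> gMor; gcomp : gMor -> gMor -> gMor; ginv : gMor -> gMor }.

Definition IsGroupoid (P : Groupoid) : Prop :=
  (forall p : gOb P, gdom (gid p) = p /\ gcod (gid p) = p)
  /\ (forall b a : gMor P, gcod a = gdom b -> gdom (gcomp b a) = gdom a /\ gcod (gcomp b a) = gcod b)
  /\ (forall a : gMor P, gcomp a (gid (gdom a)) = a /\ gcomp (gid (gcod a)) a = a)
  /\ (forall c b a : gMor P, gcod a = gdom b -> gcod b = gdom c ->
        gcomp c (gcomp b a) = gcomp (gcomp c b) a)
  /\ (forall a : gMor P, gdom (ginv a) = gcod a /\ gcod (ginv a) = gdom a /\
        gcomp (ginv a) a = gid (gdom a) /\ gcomp a (ginv a) = gid (gcod a)).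

Record RightActionData (P : Groupoid) (B : Bicat) := {
  mom : gOb P -> bOb B;
  actO : gOb P -> b1 B -> gOb P;
  actM : gMor P -> b2 B -> gMor P;
  kappa : gOb P -> b1 B -> b1 B -> gMor P;
  iota : gOb P -> gMor P }.

Section Action.
Variables (P : Groupoid) (B : Bicat) (A : RightActionData P B).
Local Notation L := (mom A).
Local Notation ao := (actO A).
Local Notation am := (actM A).

Definition IsRightAction : Prop :=
  (* the momentum is a functor to the discrete category B0 *)
  (forall a, L (gdom a) = L (gcod a))
  /\ (forall p f, L p = btgt f -> L (ao p f) = bsrc f)
  /\ (forall a phi, L (gdom a) = btgt (bdom phi) ->
        gdom (am a phi) = ao (gdom a) (bdom phi) /\
        gcod (am a phi) = ao (gcod a) (bcod phi))
  /\ (forall p f, L p = btgt f -> am (gid p) (bid2 f) = gid (ao p f))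
  /\ (forall a' a phi' phi, gcod a = gdom a' -> bcod phi = bdom phi' ->
        L (gdom a) = btgt (bdom phi) ->
        am (gcomp a' a) (bvcomp phi' phi) = gcomp (am a' phi') (am a phi))
  /\ (forall p f g, L p = btgt f -> bsrc f = btgt g ->
        gdom (kappa A p f g) = ao (ao p f) g /\ gcod (kappa A p f g) = ao p (bcomp1 f g))
  /\ (forall a phi psi, L (gdom a) = btgt (bdom phi) -> bsrc (bdom phi) = btgt (bdom psi) ->
        gcomp (am a (bhcomp phi psi)) (kappa A (gdom a) (bdom phi) (bdom psi))
        = gcomp (kappa A (gcod a) (bcod phi) (bcod psi)) (am (am a phi) psi))
  /\ (forall p, gdom (iota A p) = ao p (bid1 (L p)) /\ gcod (iota A p) = p)
  /\ (forall a, gcomp a (iota A (gdom a))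
                = gcomp (iota A (gcod a)) (am a (bid2 (bid1 (L (gdom a))))))
  (* (natural isomorphisms: automatic, P being a groupoid) *)
  /\ (forall p f g h, L p = btgt f -> bsrc f = btgt g -> bsrc g = btgt h ->
        gcomp (am (gid p) (bassoc f g h))
              (gcomp (kappa A p (bcomp1 f g) h) (am (kappa A p f g) (bid2 h)))
        = gcomp (kappa A p f (bcomp1 g h)) (kappa A (ao p f) g h))
  /\ (forall p f, L p = btgt f ->
        gcomp (am (gid p) (blunit f)) (kappa A p (bid1 (L p)) f)
        = am (iota A p) (bid2 f))
  /\ (forall p f, L p = btgt f ->
        gcomp (am (gid p) (brunit f)) (kappa A p f (bid1 (bsrc f)))
        = iota A (ao p f)).

(* The functor (Pr1, A) : P x_{B0} B1 -> P x_X P is an equivalence of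
   groupoids: fully faithful and essentially surjective. *)
Definition PairFunctorEquivalence (X : Type) (pi : gOb P -> X) : Prop :=
  (forall p f p' f', L p = btgt f -> L p' = btgt f' ->
     forall a, gdom a = p -> gcod a = p' ->
       (forall phi phi', bdom phi = f -> bcod phi = f' -> bdom phi' = f -> bcod phi' = f' ->
          am a phi = am a phi' -> phi = phi')
       /\ (forall b, gdom b = ao p f -> gcod b = ao p' f' ->
             exists phi, bdom phi = f /\ bcod phi = f' /\ am a phi = b))
  /\ (forall p p', pi p = pi p' ->
        exists q f a b, L q = btgt f /\ gdom a = q /\ gcod a = p /\
                        gdom b = ao q f /\ gcod b = p').

Definition IsRight2Torsor (X : Type) (pi : gOb P -> X) : Prop :=
  IsGroupoid P
  /\ IsRightAction
  (* pi is a functor to the discrete category X *)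
  /\ (forall a, pi (gdom a) = pi (gcod a))
  /\ (forall p f, L p = btgt f -> pi (ao p f) = pi p)
  /\ (forall a phi, L (gdom a) = btgt (bdom phi) -> pi (gdom (am a phi)) = pi (gdom a))
  /\ (forall x : X, exists p, pi p = x)
  /\ (forall y : bOb B, exists p, L p = y)
  /\ PairFunctorEquivalence pi.

End Action.

(* Bicategory data with "well-formedness" predicates on cells.  The    *)
(* 1-cells (resp. 2-cells) of the bicategory are the elements of dH1   *)
(* (resp. dH2) satisfying dok1 (resp. dok2).                           *)

Record BicatData := {
  dOb : Type; dH1 : Type; dH2 : Type;
  dok1 : dH1 -> Prop; dok2 : dH2 -> Prop;
  dsrc : dH1 -> dOb; dtgt : dH1 -> dOb;
  ddom : dH2 -> dH1; dcod : dH2 -> dH1;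
  did1 : dOb -> dH1; dcomp1 : dH1 -> dH1 -> dH1;
  did2 : dH1 -> dH2; dvcomp : dH2 -> dH2 -> dH2; dhcomp : dH2 -> dH2 -> dH2;
  dassoc : dH1 -> dH1 -> dH1 -> dH2; dlunit : dH1 -> dH2; drunit : dH1 -> dH2 }.

Definition bicat_data (B : Bicat) : BicatData :=
  {| dOb := bOb B; dH1 := b1 B; dH2 := b2 B;
     dok1 := fun _ => True; dok2 := fun _ => True;
     dsrc := @bsrc B; dtgt := @btgt B; ddom := @bdom B; dcod := @bcod B;
     did1 := @bid1 B; dcomp1 := @bcomp1 B; did2 := @bid2 B;
     dvcomp := @bvcomp B; dhcomp := @bhcomp B;
     dassoc := @bassoc B; dlunit := @blunit B; drunit := @brunit B |}.

Record BicatMap (D E : BicatData) := {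
  mO : dOb D -> dOb E; m1 : dH1 D -> dH1 E; m2 : dH2 D -> dH2 E }.

Section ActionBicat.
Variables (P : Groupoid) (B : Bicat) (A : RightActionData P B).

Record act1 := Act1 { a_src : gOb P; a_tgt : gOb P; a_mor : gMor P; a_cell : b1 B }.
Record act2 := Act2 { a_dom : act1; a_cod : act1; a_2 : b2 B }.

Definition act_ok1 (c : act1) : Prop :=
  mom A (a_src c) = bsrc (a_cell c) /\ mom A (a_tgt c) = btgt (a_cell c) /\
  gdom (a_mor c) = a_src c /\ gcod (a_mor c) = actO A (a_tgt c) (a_cell c).

Definition act_ok2 (g : act2) : Prop :=
  act_ok1 (a_dom g) /\ act_ok1 (a_cod g) /\
  a_src (a_dom g) = a_src (a_cod g) /\ a_tgt (a_dom g) = a_tgt (a_cod g) /\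
  bdom (a_2 g) = a_cell (a_dom g) /\ bcod (a_2 g) = a_cell (a_cod g) /\
  gcomp (actM A (gid (a_tgt (a_dom g))) (a_2 g)) (a_mor (a_dom g)) = a_mor (a_cod g).

Definition act_id1 (p : gOb P) : act1 :=
  Act1 p p (ginv (iota A p)) (bid1 (mom A p)).

Definition act_comp1 (c2 c1 : act1) : act1 :=
  Act1 (a_src c1) (a_tgt c2)
    (gcomp (kappa A (a_tgt c2) (a_cell c2) (a_cell c1))
       (gcomp (actM A (a_mor c2) (bid2 (a_cell c1))) (a_mor c1)))
    (bcomp1 (a_cell c2) (a_cell c1)).

Definition act_id2 (c : act1) : act2 := Act2 c c (bid2 (a_cell c)).
Definition act_vcomp (g2 g1 : act2) : act2 :=
  Act2 (a_dom g1) (a_cod g2) (bvcomp (a_2 g2) (a_2 g1)).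
Definition act_hcomp (g2 g1 : act2) : act2 :=
  Act2 (act_comp1 (a_dom g2) (a_dom g1)) (act_comp1 (a_cod g2) (a_cod g1))
       (bhcomp (a_2 g2) (a_2 g1)).
Definition act_assoc (h g f : act1) : act2 :=
  Act2 (act_comp1 (act_comp1 h g) f) (act_comp1 h (act_comp1 g f))
       (bassoc (a_cell h) (a_cell g) (a_cell f)).
Definition act_lunit (f : act1) : act2 :=
  Act2 (act_comp1 (act_id1 (a_tgt f)) f) f (blunit (a_cell f)).
Definition act_runit (f : act1) : act2 :=
  Act2 (act_comp1 f (act_id1 (a_src f))) f (brunit (a_cell f)).

Definition ActionBicat : BicatData :=
  {| dOb := gOb P; dH1 := act1; dH2 := act2;
     dok1 := act_ok1; dok2 := act_ok2;
     dsrc := a_src; dtgt := a_tgt; ddom := a_dom; dcod := a_cod;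
     did1 := act_id1; dcomp1 := act_comp1; did2 := act_id2;
     dvcomp := act_vcomp; dhcomp := act_hcomp;
     dassoc := act_assoc; dlunit := act_lunit; drunit := act_runit |}.

Definition ActionProjection : BicatMap ActionBicat (bicat_data B) :=
  @Build_BicatMap ActionBicat (bicat_data B) (mom A) a_cell a_2.

End ActionBicat.

(* Raw data of a map [n] -> D : objects x_i, 1-cells f_ij (i <= j) and
   2-cells phi_ijk : f_jk o f_ij => f_ik (i <= j <= k). *)
Record simplex (D : BicatData) (n : nat) := Simplex {
  sob : 'I_n.+1 -> dOb D;
  sar : forall i j : 'I_n.+1, (i <= j)%N -> dH1 D;
  sce : forall i j k : 'I_n.+1, (i <= j)%N -> (j <= k)%N -> dH2 D }.
Arguments sob {D n} s i : rename.
Arguments sar {D n} s i j _ : rename.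
Arguments sce {D n} s i j k _ _ : rename.

Definition iso2 (D : BicatData) (a : dH2 D) : Prop :=
  exists b, dok2 b /\ ddom b = dcod a /\ dcod b = ddom a /\
    dvcomp b a = did2 (ddom a) /\ dvcomp a b = did2 (dcod a).

(* x is a normal (strictly unital) homomorphism [n] -> D.  *)
Definition is_nerve_simplex (D : BicatData) (n : nat) (x : simplex D n) : Prop :=
  (forall (i j : 'I_n.+1) (h : (i <= j)%N),
     dok1 (sar x i j h) /\ dsrc (sar x i j h) = sob x i /\ dtgt (sar x i j h) = sob x j)
  /\ (forall i : 'I_n.+1, sar x i i (leqnn i) = did1 (sob x i))
  /\ (forall (i j k : 'I_n.+1) (h1 : (i <= j)%N) (h2 : (j <= k)%N),
        dok2 (sce x i j k h1 h2)
        /\ ddom (sce x i j k h1 h2) = dcomp1 (sar x j k h2) (sar x i j h1)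
        /\ dcod (sce x i j k h1 h2) = sar x i k (leq_trans h1 h2)
        /\ iso2 (sce x i j k h1 h2))
  (* normality (unit axioms with identity unit constraints) *)
  /\ (forall (i j : 'I_n.+1) (h : (i <= j)%N),
        sce x i i j (leqnn i) h = drunit (sar x i j h))
  /\ (forall (i j : 'I_n.+1) (h : (i <= j)%N),
        sce x i j j h (leqnn j) = dlunit (sar x i j h))
  /\ (forall (i j k l : 'I_n.+1) (h1 : (i <= j)%N) (h2 : (j <= k)%N) (h3 : (k <= l)%N),
        dvcomp (sce x i k l (leq_trans h1 h2) h3)
          (dvcomp (dhcomp (did2 (sar x k l h3)) (sce x i j k h1 h2))
                  (dassoc (sar x k l h3) (sar x j k h2) (sar x i j h1)))
        = dvcomp (sce x i j l h1 (leq_trans h2 h3))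
                 (dhcomp (sce x j k l h2 h3) (did2 (sar x i j h1)))).

Definition precomp (D : BicatData) (m n : nat) (theta : 'I_m.+1 -> 'I_n.+1)
  (htheta : forall i j : 'I_m.+1, (i <= j)%N -> (theta i <= theta j)%N)
  (x : simplex D n) : simplex D m :=
  {| sob := fun i => sob x (theta i);
     sar := fun i j h => sar x (theta i) (theta j) (htheta i j h);
     sce := fun i j k h1 h2 =>
              sce x (theta i) (theta j) (theta k) (htheta i j h1) (htheta j k h2) |}.

Lemma lift_homo (n : nat) (i : 'I_n.+2) :
  forall j k : 'I_n.+1, (j <= k)%N -> (lift i j <= lift i k)%N.
Proof. by move=> j k hjk; rewrite /= leq_bump2. Qed.

Definition face (D : BicatData) (n i : nat) (x : simplex D n.+1) : simplex D n :=
  precomp (lift_homo (@inord n.+1 i)) x.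

Definition nerve_map (D E : BicatData) (F : BicatMap D E) (n : nat)
  (x : simplex D n) : simplex E n :=
  {| sob := fun i => mO F (sob x i);
     sar := fun i j h => m1 F (sar x i j h);
     sce := fun i j k h1 h2 => m2 F (sce x i j k h1 h2) |}.

Section SimplicialProps.
Variables (D E : BicatData) (F : BicatMap D E).

(* The map E_n -> Horn^k_n(E) x_{Horn^k_n(Y)} Y_n is a bijection, for
   n = m+2 and every 0 <= k <= n (E = N_2 D, Y = N_2 E). *)
Definition exact_fibration_in_dim (m : nat) : Prop :=
  forall k : nat, (k <= m.+2)%N ->
  (forall x x' : simplex D m.+2, is_nerve_simplex x -> is_nerve_simplex x' ->
     (forall i, (i <= m.+2)%N -> i != k -> face i x = face i x') ->
     nerve_map F x = nerve_map F x' -> x = x')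
  /\ (forall y : nat -> simplex D m.+1,
        (forall i, (i <= m.+2)%N -> i != k -> is_nerve_simplex (y i)) ->
        (forall i j, (i < j)%N -> (j <= m.+2)%N -> i != k -> j != k ->
           face i (y j) = face j.-1 (y i)) ->
        forall z : simplex E m.+2, is_nerve_simplex z ->
        (forall i, (i <= m.+2)%N -> i != k -> face i z = nerve_map F (y i)) ->
        exists x : simplex D m.+2, is_nerve_simplex x /\
          (forall i, (i <= m.+2)%N -> i != k -> face i x = y i) /\
          nerve_map F x = z).

Definition boundary_surjective (m : nat) : Prop :=
  forall y : nat -> simplex D m.+1,
    (forall i, (i <= m.+2)%N -> is_nerve_simplex (y i)) ->
    (forall i j, (i < j)%N -> (j <= m.+2)%N -> face i (y j) = face j.-1 (y i)) ->
    exists x : simplex D m.+2, is_nerve_simplex x /\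
      (forall i, (i <= m.+2)%N -> face i x = y i).

Definition boundary_injective (m : nat) : Prop :=
  forall x x' : simplex D m.+2, is_nerve_simplex x -> is_nerve_simplex x' ->
    (forall i, (i <= m.+2)%N -> face i x = face i x') -> x = x'.

Variables (X : Type) (pi : dOb D -> X).

Definition pi0 (x : simplex D 0) : X := pi (sob x ord0).

Definition Augmented : Prop :=
  forall x : simplex D 1, is_nerve_simplex x -> pi0 (face 0 x) = pi0 (face 1 x).

Definition Aspherical : Prop :=
  (forall xi : X, exists x : simplex D 0, is_nerve_simplex x /\ pi0 x = xi)
  /\ (forall y0 y1 : simplex D 0, is_nerve_simplex y0 -> is_nerve_simplex y1 ->
        pi0 y0 = pi0 y1 ->
        exists x : simplex D 1, is_nerve_simplex x /\ face 0 x = y0 /\ face 1 x = y1)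
  /\ (forall m, boundary_surjective m).

Definition OneCoskeletal : Prop :=
  forall m, boundary_injective m /\ boundary_surjective m.

Definition DuskinGlenn2Torsor : Prop :=
  (forall m, exact_fibration_in_dim m) /\ Augmented /\ Aspherical /\ OneCoskeletal.

End SimplicialProps.

(* Main.v *)
(* Full faithfulness of the torsor functor makes the 2-cells of the action
   bicategory between parallel 1-cells unique and always existing.  Hence a simplex
   of its nerve is determined by its edges, and any compatible family of edges with
   identities on the diagonal fills to a simplex.  This gives 1-coskeletality, and
   the fibration property in dimension at least 3 up to the 2-cells of the base,
   where three faces of a tetrahedron determine the fourth.  For 2-horns one solves
   [(p <| gamma) kappa (psi <| g) phi = xi] for one of [psi], [phi], [xi]; solving
   for [psi] uses that [- <| g] is fully faithful, [g] being an equivalence. *)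
Require Import Defs.
From mathcomp Require Import all_boot zify.
From Stdlib Require Import FunctionalExtensionality IndefiniteDescription.
Set Implicit Arguments. Unset Strict Implicit. Unset Printing Implicit Defensive.

(** Coherence of the action bicategory is never computed with. Every equation between its 2-cells,
    be it a unit law, a cocycle condition or invertibility, follows from uniqueness once both sides
    are known to be well formed, and the three coherence axioms of an action enter only in proving
    that well-formedness. The projection is less automatic, since 2-cells of the base are not
    determined by their edges. In the [k]-th horn a triangle on vertices [a], [b], [c] lies in a
    given face as soon as some vertex differs from [a], [b], [c] and [k]. In dimension 3 this fails
    when the four are distinct, hence the appeal to a tetrahedron. The cocycle condition shows two
    of its faces only whiskered by an edge; the whiskering is undone by letting the 2-cells act on
    an object of the torsor over the last vertex, which exists because the momentum is
    surjective. *)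

Ltac axiom_of :=
  repeat match goal with K : _ /\ _ |- _ => destruct K end;
  intros; match goal with
  | K : _ |- _ => solve [apply K; assumption | symmetry; apply K; assumption]
  end.

(** * Bigroupoids *)

Section Bigroupoids.
Variable B : Bicat.
Hypothesis HB : IsBigroupoid B.

(** An axiom is extracted by restating it: all conjunctions are split and the matching component
    closes the goal. *)
Ltac ax := move: HB; rewrite /IsBigroupoid /IsBicat => ?; axiom_of.

Lemma bsrc_id1 (x : bOb B) : bsrc (bid1 x) = x. Proof. ax. Qed.
Lemma btgt_id1 (x : bOb B) : btgt (bid1 x) = x. Proof. ax. Qed.
Lemma bsrc_comp1 (g f : b1 B) : bsrc g = btgt f -> bsrc (bcomp1 g f) = bsrc f.
Proof. ax. Qed.
Lemma btgt_comp1 (g f : b1 B) : bsrc g = btgt f -> btgt (bcomp1 g f) = btgt g.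
Proof. ax. Qed.
Lemma bsrc_cod (a : b2 B) : bsrc (bcod a) = bsrc (bdom a). Proof. ax. Qed.
Lemma btgt_cod (a : b2 B) : btgt (bcod a) = btgt (bdom a). Proof. ax. Qed.
Lemma bdom_id2 (f : b1 B) : bdom (bid2 f) = f. Proof. ax. Qed.
Lemma bcod_id2 (f : b1 B) : bcod (bid2 f) = f. Proof. ax. Qed.
Lemma bdom_vcomp (b a : b2 B) : bcod a = bdom b -> bdom (bvcomp b a) = bdom a.
Proof. ax. Qed.
Lemma bcod_vcomp (b a : b2 B) : bcod a = bdom b -> bcod (bvcomp b a) = bcod b.
Proof. ax. Qed.
Lemma bdom_hcomp (b a : b2 B) : bsrc (bdom b) = btgt (bdom a) ->
  bdom (bhcomp b a) = bcomp1 (bdom b) (bdom a).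
Proof. ax. Qed.
Lemma bcod_hcomp (b a : b2 B) : bsrc (bdom b) = btgt (bdom a) ->
  bcod (bhcomp b a) = bcomp1 (bcod b) (bcod a).
Proof. ax. Qed.
Lemma bdom_assoc (h g f : b1 B) : bsrc h = btgt g -> bsrc g = btgt f ->
  bdom (bassoc h g f) = bcomp1 (bcomp1 h g) f.
Proof. ax. Qed.
Lemma bcod_assoc (h g f : b1 B) : bsrc h = btgt g -> bsrc g = btgt f ->
  bcod (bassoc h g f) = bcomp1 h (bcomp1 g f).
Proof. ax. Qed.
Lemma bdom_lunit (f : b1 B) : bdom (blunit f) = bcomp1 (bid1 (btgt f)) f.
Proof. ax. Qed.
Lemma bcod_lunit (f : b1 B) : bcod (blunit f) = f. Proof. ax. Qed.
Lemma bdom_runit (f : b1 B) : bdom (brunit f) = bcomp1 f (bid1 (bsrc f)).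
Proof. ax. Qed.
Lemma bcod_runit (f : b1 B) : bcod (brunit f) = f. Proof. ax. Qed.
Lemma bvcomp_id (a : b2 B) : bvcomp a (bid2 (bdom a)) = a. Proof. ax. Qed.
Lemma bid_vcomp (a : b2 B) : bvcomp (bid2 (bcod a)) a = a. Proof. ax. Qed.
Lemma bvcompA (c b a : b2 B) : bcod a = bdom b -> bcod b = bdom c ->
  bvcomp c (bvcomp b a) = bvcomp (bvcomp c b) a.
Proof. ax. Qed.
Lemma bhcomp_id (g f : b1 B) : bsrc g = btgt f ->
  bhcomp (bid2 g) (bid2 f) = bid2 (bcomp1 g f).
Proof. ax. Qed.
Lemma b2_iso (a : b2 B) : is_iso2 a. Proof. ax. Qed.
Lemma b1_equiv (f : b1 B) : exists g, bsrc g = btgt f /\ btgt g = bsrc f /\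
  (exists u, bdom u = bcomp1 g f /\ bcod u = bid1 (bsrc f) /\ is_iso2 u) /\
  (exists v, bdom v = bcomp1 f g /\ bcod v = bid1 (btgt f) /\ is_iso2 v).
Proof. ax. Qed.

Lemma bvcomp_injl (b a a' : b2 B) : bcod a = bdom b -> bcod a' = bdom b ->
  bvcomp b a = bvcomp b a' -> a = a'.
Proof.
have [c [cd [cc [cb _]]]] := b2_iso b => ca ca' e.
by rewrite -(bid_vcomp a) -(bid_vcomp a') ca ca' -cb -!bvcompA // e.
Qed.

Lemma bvcomp_injr (a b b' : b2 B) : bcod a = bdom b -> bcod a = bdom b' ->
  bvcomp b a = bvcomp b' a -> b = b'.
Proof.
have [c [cd [cc [_ cb]]]] := b2_iso a => ca ca' e.
by rewrite -(bvcomp_id b) -(bvcomp_id b') -ca -ca' -cb !bvcompA // e.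
Qed.

End Bigroupoids.

(** * Faces and gluing of simplices *)

Section Simplices.
Variable D : BicatData.

(** Cells are indexed by proofs of boolean inequalities, which are unique, so a cell depends only on
    its vertices. *)
Lemma sar_irr n (x : simplex D n) i j i' j' h h' : i = i' -> j = j' ->
  sar x i j h = sar x i' j' h'.
Proof. by move=> ei ej; subst; rewrite (bool_irrelevance h h'). Qed.

Lemma sce_irr n (x : simplex D n) i j k i' j' k' h1 h2 h1' h2' :
  i = i' -> j = j' -> k = k' -> sce x i j k h1 h2 = sce x i' j' k' h1' h2'.
Proof.
by move=> ei ej ek; subst; rewrite (bool_irrelevance h1 h1') (bool_irrelevance h2 h2').
Qed.

Lemma simplex_ext n (x x' : simplex D n) : (forall i, sob x i = sob x' i) ->
  (forall i j h, sar x i j h = sar x' i j h) ->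
  (forall i j k h1 h2, sce x i j k h1 h2 = sce x' i j k h1 h2) -> x = x'.
Proof.
case: x x' => [o a c] [o' a' c'] /= eo ea ec; congr Simplex.
- exact: functional_extensionality_dep.
- by do 3![apply: functional_extensionality_dep => ?].
- by do 5![apply: functional_extensionality_dep => ?].
Qed.

Lemma nerve_precomp m n (theta : 'I_m.+1 -> 'I_n.+1)
    (mono : forall i j : 'I_m.+1, i <= j -> theta i <= theta j) (x : simplex D n) :
  is_nerve_simplex x -> is_nerve_simplex (precomp mono x).
Proof.
move=> [ar [unit_ [ce [lun [run coc]]]]].
split; first by move=> *; apply: ar.
split; first by move=> i /=; rewrite -unit_; apply: sar_irr.
split.
  move=> i j k h1 h2; have [k2 [d2 [c2 i2]]] := ce _ _ _ (mono i j h1) (mono j k h2).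
  by do 3?split=> //; rewrite /= c2; apply: sar_irr.
split; first by move=> i j h /=; rewrite -lun; apply: sce_irr.
split; first by move=> i j h /=; rewrite -run; apply: sce_irr.
move=> i j k l h1 h2 h3 /=; have := coc _ _ _ _ (mono _ _ h1) (mono _ _ h2) (mono _ _ h3).
(* The two forms of the cocycle condition differ only in whether transitivity is applied before or
   after [mono]. *)
rewrite (sce_irr x _ _ (mono _ _ (leq_trans h1 h2)) (mono _ _ h3)) // => ->.
by congr dvcomp; apply: sce_irr.
Qed.

Lemma lift_preimage n (k i : 'I_n.+2) : i != k -> exists i', lift k i' = i.
Proof. by rewrite eq_sym => /unlift_some[i' -> _]; exists i'. Qed.

Section Faces.
Variables (n : nat) (k : 'I_n.+2) (x x' : simplex D n.+1).
Hypothesis eq_face : face k x = face k x'.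

(** A vertex other than [k] is in the image of [lift k], and [face k] is precomposition with that
    map; [inord_val] undoes the passage of [k] through [nat]. *)
Lemma sob_face i : i != k -> sob x i = sob x' i.
Proof.
by case/lift_preimage=> i' <-; have /(congr1 (fun y => sob y i')) := eq_face; rewrite /= inord_val.
Qed.

Lemma lift_leq (i j : 'I_n.+1) : lift k i <= lift k j -> i <= j.
Proof. by rewrite leq_bump2. Qed.

Lemma sar_face i j h : i != k -> j != k -> sar x i j h = sar x' i j h.
Proof.
case/lift_preimage=> i' ei /lift_preimage[j' ej]; subst.
have := congr1 (fun y => sar y i' j' (lift_leq h)) eq_face => /= e.
by apply: etrans (etrans e _); apply: sar_irr; rewrite inord_val.
Qed.

Lemma sce_face i j l h1 h2 : i != k -> j != k -> l != k ->
  sce x i j l h1 h2 = sce x' i j l h1 h2.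
Proof.
case/lift_preimage=> i' ei /lift_preimage[j' ej] /lift_preimage[l' el]; subst.
have := congr1 (fun y => sce y i' j' l' (lift_leq h1) (lift_leq h2)) eq_face => /= e.
by apply: etrans (etrans e _); apply: sce_irr; rewrite inord_val.
Qed.

End Faces.

(** By counting. The vertex [l] found serves as the index of a face, since the [l]-th face contains
    every vertex other than [l]. *)
Lemma ord_avoid n (s : seq 'I_n) : size s < n -> exists l, l \notin s.
Proof.
move=> lt_s; apply/existsP; apply: contraLR lt_s; rewrite negb_exists => /forallP none.
rewrite -leqNgt -[X in X <= _]card_ord; apply: leq_trans (card_size s).
by apply/subset_leq_card/subsetP => l _; rewrite -[l \in s]negbK none.
Qed.

Section Gluing.
Variables (m : nat) (S : pred nat) (y : nat -> simplex D m.+1).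
Hypothesis compat : forall i j, i < j -> j <= m.+2 -> S i -> S j ->
  face i (y j) = face j.-1 (y i).

(** The cosimplicial identity read backwards: a vertex common to the faces [l < l'] comes from their
    intersection, which is face [l'.-1] of the former and face [l] of the latter. *)
Lemma lift_swap (l l' : 'I_m.+3) (a a' : 'I_m.+2) : l < l' -> lift l a = lift l' a' ->
  exists b : 'I_m.+1, lift (inord l'.-1) b = a /\ lift (inord l) b = a'.
Proof.
move=> lt_l /(congr1 val) /= e.
have lt_l2 : l < m.+2 by have := ltn_ord l'; lia.
have lt_l'2 : l'.-1 < m.+2 by have := ltn_ord l'; lia.
have [b eb] : exists b, lift (inord l : 'I_m.+2) b = a'.
  apply: lift_preimage; apply: contra_eqN e => /eqP ->.
  by rewrite inordK // /bump; lia.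
exists b; split=> //; apply: val_inj; move: e; rewrite -eb /= !inordK // /bump; lia.
Qed.

(** A common edge comes from the intersection of the two faces, where [compat] equates its two
    values. The predicate [S] selects the given faces: all of them for a boundary, all but one for a
    horn. *)
Lemma glue_sar (l l' : 'I_m.+3) a b a' b' h h' : S l -> S l' ->
  lift l a = lift l' a' -> lift l b = lift l' b' ->
  sar (y l) a b h = sar (y l') a' b' h'.
Proof.
wlog lt_l : l l' a b a' b' h h' / l < l' => [gen|] Sl Sl' ea eb.
  have [|lt_l|e] := ltngtP l l'; first by move=> *; apply: gen.
    by apply/esym/gen.
  have {}e := val_inj e; subst l'.
  by apply: sar_irr; [apply: lift_inj ea | apply: lift_inj eb].
have [c [ec ec']] := lift_swap lt_l ea; have [d [ed ed']] := lift_swap lt_l eb; subst.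
have cd : c <= d by move: h; rewrite leq_bump2.
have le_l' : l' <= m.+2 by rewrite -ltnS.
have /(congr1 (fun z => sar z c d cd)) /= := compat lt_l le_l' Sl Sl'.
by rewrite (sar_irr (y l) _ h) // => <-; apply: sar_irr.
Qed.

End Gluing.
End Simplices.

(** * Torsors over a bigroupoid *)

Section Actions.
Variables (B : Bicat) (P : Groupoid) (A : RightActionData P B).
Variables (X : Type) (pi : gOb P -> X).
Hypothesis HB : IsBigroupoid B.
Hypothesis HT : IsRight2Torsor A pi.

Local Notation L := (mom A).
Local Notation "p <| f" := (actO A p f) (at level 40, left associativity).
Local Notation "a <: phi" := (actM A a phi) (at level 40, left associativity).
Local Notation "b ** a" := (gcomp b a) (at level 50, left associativity).

Ltac ax := move: HT;
  rewrite /IsRight2Torsor /IsGroupoid /IsRightAction /PairFunctorEquivalence => ?; axiom_of.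

Lemma gdom_id p : gdom (gid p) = p :> gOb P. Proof. ax. Qed.
Lemma gcod_id p : gcod (gid p) = p :> gOb P. Proof. ax. Qed.
Lemma gdom_comp (b a : gMor P) : gcod a = gdom b -> gdom (b ** a) = gdom a.
Proof. ax. Qed.
Lemma gcod_comp (b a : gMor P) : gcod a = gdom b -> gcod (b ** a) = gcod b.
Proof. ax. Qed.
Lemma gdom_inv (a : gMor P) : gdom (ginv a) = gcod a. Proof. ax. Qed.
Lemma gcod_inv (a : gMor P) : gcod (ginv a) = gdom a. Proof. ax. Qed.
Lemma gcompA (c b a : gMor P) : gcod a = gdom b -> gcod b = gdom c ->
  c ** (b ** a) = c ** b ** a.
Proof. ax. Qed.
Lemma gcomp_id (a : gMor P) : a ** gid (gdom a) = a. Proof. ax. Qed.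
Lemma gid_comp (a : gMor P) : gid (gcod a) ** a = a. Proof. ax. Qed.
Lemma ginv_comp (a : gMor P) : ginv a ** a = gid (gdom a). Proof. ax. Qed.
Lemma gcomp_inv (a : gMor P) : a ** ginv a = gid (gcod a). Proof. ax. Qed.

Lemma mom_cod (a : gMor P) : L (gcod a) = L (gdom a). Proof. ax. Qed.
Lemma mom_act p f : L p = btgt f -> L (p <| f) = bsrc f. Proof. ax. Qed.
Lemma gdom_act a phi : L (gdom a) = btgt (bdom phi) ->
  gdom (a <: phi) = gdom a <| bdom phi.
Proof. ax. Qed.
Lemma gcod_act a phi : L (gdom a) = btgt (bdom phi) ->
  gcod (a <: phi) = gcod a <| bcod phi.
Proof. ax. Qed.
Lemma act_id p f : L p = btgt f -> gid p <: bid2 f = gid (p <| f). Proof. ax. Qed.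
Lemma act_comp a' a phi' phi : gcod a = gdom a' -> bcod phi = bdom phi' ->
  L (gdom a) = btgt (bdom phi) ->
  (a' ** a) <: bvcomp phi' phi = (a' <: phi') ** (a <: phi).
Proof. ax. Qed.
Lemma gdom_kappa p f g : L p = btgt f -> bsrc f = btgt g ->
  gdom (kappa A p f g) = p <| f <| g.
Proof. ax. Qed.
Lemma gcod_kappa p f g : L p = btgt f -> bsrc f = btgt g ->
  gcod (kappa A p f g) = p <| bcomp1 f g.
Proof. ax. Qed.
Lemma kappa_nat a phi psi : L (gdom a) = btgt (bdom phi) ->
  bsrc (bdom phi) = btgt (bdom psi) ->
  (a <: bhcomp phi psi) ** kappa A (gdom a) (bdom phi) (bdom psi)
  = kappa A (gcod a) (bcod phi) (bcod psi) ** (a <: phi <: psi).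
Proof. ax. Qed.
Lemma gdom_iota p : gdom (Defs.iota A p) = p <| bid1 (L p). Proof. ax. Qed.
Lemma gcod_iota p : gcod (Defs.iota A p) = p. Proof. ax. Qed.
Lemma iota_nat a : a ** Defs.iota A (gdom a)
  = Defs.iota A (gcod a) ** (a <: bid2 (bid1 (L (gdom a)))).
Proof. ax. Qed.
Lemma kappa_assoc p f g h : L p = btgt f -> bsrc f = btgt g -> bsrc g = btgt h ->
  (gid p <: bassoc f g h) ** (kappa A p (bcomp1 f g) h ** (kappa A p f g <: bid2 h))
  = kappa A p f (bcomp1 g h) ** kappa A (p <| f) g h.
Proof. ax. Qed.
Lemma kappa_lunit p f : L p = btgt f ->
  (gid p <: blunit f) ** kappa A p (bid1 (L p)) f = Defs.iota A p <: bid2 f.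
Proof. ax. Qed.
Lemma kappa_runit p f : L p = btgt f ->
  (gid p <: brunit f) ** kappa A p f (bid1 (bsrc f)) = Defs.iota A (p <| f).
Proof. ax. Qed.
Lemma pi_cod (a : gMor P) : pi (gcod a) = pi (gdom a). Proof. ax. Qed.
Lemma pi_act p f : L p = btgt f -> pi (p <| f) = pi p. Proof. ax. Qed.
Lemma pi_surj x : exists p, pi p = x. Proof. ax. Qed.
Lemma mom_surj y : exists p, L p = y. Proof. ax. Qed.

(** Faithfulness of the torsor functor over [gid p]. Together with [act2_full] it identifies 2-cells
    from [f] to [g] with morphisms from [p <| f] to [p <| g]. *)
Lemma act2_inj p f g phi phi' : L p = btgt f -> L p = btgt g ->
  bdom phi = f -> bcod phi = g -> bdom phi' = f -> bcod phi' = g ->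
  gid p <: phi = gid p <: phi' -> phi = phi'.
Proof.
case: HT => _ [_ [_ [_ [_ [_ [_ [ff _]]]]]]] Lf Lg.
by have [inj _] := ff p f p g Lf Lg _ (gdom_id p) (gcod_id p); apply: inj.
Qed.

Lemma act2_full p f g b : L p = btgt f -> L p = btgt g ->
  gdom b = p <| f -> gcod b = p <| g ->
  exists phi, bdom phi = f /\ bcod phi = g /\ gid p <: phi = b.
Proof.
case: HT => _ [_ [_ [_ [_ [_ [_ [ff _]]]]]]] Lf Lg.
by have [_] := ff p f p g Lf Lg _ (gdom_id p) (gcod_id p); apply.
Qed.

Lemma act_ess_surj p p' : pi p = pi p' ->
  exists q f a b, L q = btgt f /\ gdom a = q /\ gcod a = p /\
                  gdom b = q <| f /\ gcod b = p'.
Proof. ax. Qed.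

Lemma gcomp_injl (b a a' : gMor P) : gcod a = gdom b -> gcod a' = gdom b ->
  b ** a = b ** a' -> a = a'.
Proof.
move=> ca ca' e; rewrite -(gid_comp a) -(gid_comp a') ca ca' -ginv_comp.
by rewrite -!gcompA ?gcod_inv ?e // gdom_inv.
Qed.

Lemma gcomp_injr (a b b' : gMor P) : gcod a = gdom b -> gcod a = gdom b' ->
  b ** a = b' ** a -> b = b'.
Proof.
move=> ca ca' e; rewrite -(gcomp_id b) -(gcomp_id b') -ca -ca' -gcomp_inv.
by rewrite !gcompA ?gcod_inv ?e // gdom_inv.
Qed.

(** Operations are total, so every axiom carries composability conditions. This tactic computes
    sources and targets, calls itself on the conditions of each rewrite, and leaves the rest to
    [congruence]. *)
Ltac ty := first [done |
  repeat first
   [ rewrite (bsrc_cod HB) | rewrite (btgt_cod HB)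
   | rewrite (bsrc_id1 HB) | rewrite (btgt_id1 HB)
   | rewrite (bsrc_comp1 HB); [|ty] | rewrite (btgt_comp1 HB); [|ty]
   | rewrite (bdom_id2 HB) | rewrite (bcod_id2 HB)
   | rewrite (bdom_vcomp HB); [|ty] | rewrite (bcod_vcomp HB); [|ty]
   | rewrite (bdom_hcomp HB); [|ty] | rewrite (bcod_hcomp HB); [|ty]
   | rewrite (bdom_assoc HB); [|ty|ty] | rewrite (bcod_assoc HB); [|ty|ty]
   | rewrite (bdom_lunit HB) | rewrite (bcod_lunit HB)
   | rewrite (bdom_runit HB) | rewrite (bcod_runit HB)
   | rewrite gdom_id | rewrite gcod_id
   | rewrite gdom_inv | rewrite gcod_inv
   | rewrite gdom_comp; [|ty] | rewrite gcod_comp; [|ty]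
   | rewrite gdom_act; [|ty] | rewrite gcod_act; [|ty]
   | rewrite gdom_kappa; [|ty|ty] | rewrite gcod_kappa; [|ty|ty]
   | rewrite gdom_iota | rewrite gcod_iota
   | rewrite mom_act; [|ty]
   | match goal with
     | K : bdom ?a = _ |- context [bdom ?a] => rewrite K
     | K : bcod ?a = _ |- context [bcod ?a] => rewrite K
     | K : gdom ?a = _ |- context [gdom ?a] => rewrite K
     | K : gcod ?a = _ |- context [gcod ?a] => rewrite K
     end
   | rewrite mom_cod ];
  solve [done | congruence] ].

Lemma act_compl a' a f : gcod a = gdom a' -> L (gdom a) = btgt f ->
  (a' ** a) <: bid2 f = (a' <: bid2 f) ** (a <: bid2 f).
Proof.
move=> e Lf; rewrite -act_comp //; try ty.
by rewrite -{3}(bdom_id2 HB f) (bvcomp_id HB).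
Qed.

Lemma act_compr p phi' phi : bcod phi = bdom phi' -> L p = btgt (bdom phi) ->
  gid p <: bvcomp phi' phi = (gid p <: phi') ** (gid p <: phi).
Proof.
move=> e Lf; rewrite -act_comp //; try ty.
by rewrite -{3}(gdom_id p) gcomp_id.
Qed.

Lemma act_split a phi : L (gdom a) = btgt (bdom phi) ->
  a <: phi = (a <: bid2 (bcod phi)) ** (gid (gdom a) <: phi).
Proof.
by move=> e; rewrite -act_comp ?gcomp_id ?(bid_vcomp HB) //; ty.
Qed.

Lemma act_split' a phi : L (gdom a) = btgt (bdom phi) ->
  a <: phi = (gid (gcod a) <: phi) ** (a <: bid2 (bdom phi)).
Proof.
by move=> e; rewrite -act_comp ?gid_comp ?(bvcomp_id HB) //; ty.
Qed.

(* [- <| f] has a left inverse [- <| g] up to natural isomorphism.  Since this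
   also holds for [g], the functor [- <| f] is fully faithful. *)
Lemma act_retract f : exists g (theta : gOb P -> gMor P),
  btgt g = bsrc f /\
  (forall p, L p = btgt f -> gdom (theta p) = p <| f <| g /\ gcod (theta p) = p) /\
  (forall a, L (gdom a) = btgt f ->
     a ** theta (gdom a) = theta (gcod a) ** (a <: bid2 f <: bid2 g)).
Proof.
have [g [sg [tg [_ [v [dv [cv _]]]]]]] := b1_equiv HB f.
(* [theta p] is the composite [p <| f <| g -> p <| (f o g) -> p <| i -> p], with [v] the 2-cell
   contracting [f o g] to an identity. *)
exists g, (fun p => Defs.iota A p ** ((gid p <: v) ** kappa A p f g)).
split=> //; split=> [p Lf|b Lf]; first by split; ty.
rewrite gcompA; try ty.
rewrite iota_nat -!gcompA; try ty.
congr (_ ** _); rewrite !gcompA; try ty.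
have := kappa_nat (a := b) (phi := bid2 f) (psi := bid2 g).
rewrite !(bdom_id2 HB) !(bcod_id2 HB) => k.
rewrite -[RHS]gcompA; try ty.
rewrite -k; try ty.
rewrite [RHS]gcompA; try ty.
congr (_ ** _); rewrite Lf (bhcomp_id HB); try ty.
have Lv : L (gdom b) = btgt (bdom v) by ty.
by rewrite -dv -cv -act_split // -act_split'.
Qed.

Lemma act_faithful a a' f : L (gdom a) = btgt f ->
  gdom a = gdom a' -> gcod a = gcod a' ->
  a <: bid2 f = a' <: bid2 f -> a = a'.
Proof.
move=> Lf ed ec e; have [g [theta [tg [theta_dc nat]]]] := act_retract f.
(* Once [e] is used, the naturality squares of [a] and [a'] share a side; cancelling [theta] leaves
   [a = a']. *)
have := nat a Lf; rewrite e ed ec -nat -?ed //.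
by apply: gcomp_injr; rewrite (theta_dc _ _).2 // -ed.
Qed.

Lemma act_full p p' f b : L p = btgt f -> L p' = btgt f ->
  gdom b = p <| f -> gcod b = p' <| f ->
  exists a, gdom a = p /\ gcod a = p' /\ a <: bid2 f = b.
Proof.
move=> Lp Lp' db cb; have [g [theta [tg [theta_dc nat]]]] := act_retract f.
have [[d c] [d' c']] := (theta_dc p Lp, theta_dc p' Lp').
set a := theta p' ** (b <: bid2 g) ** ginv (theta p).
have da : gdom a = p by rewrite /a; ty.
have ca : gcod a = p' by rewrite /a; ty.
exists a; split=> //; split=> //.
(* Faithfulness is now used for [g]: it suffices to compare [a <: bid2 f] with [b] after acting by
   [g], where naturality of [theta] at [a] applies. *)
apply: (@act_faithful _ _ g); try ty.
apply: (gcomp_injl (b := theta p')); try ty.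
rewrite -{1}ca -nat ?da // -gcompA; try ty.
have e : gdom (b <: bid2 g) = p <| f <| g by ty.
by rewrite ginv_comp d -e -gcompA ?gcomp_id //; ty.
Qed.

(** * The action bicategory *)

Local Notation ok1 := (act_ok1 A).
Local Notation ok2 := (act_ok2 A).
Local Notation comp1 := (act_comp1 A).
Local Notation id1 := (act_id1 A).

Lemma act_ok1_id p : ok1 (id1 p).
Proof. by split=> /=; [|split; [|split]]; ty. Qed.

Lemma act_ok1_comp d c : ok1 d -> ok1 c -> a_src d = a_tgt c -> ok1 (comp1 d c).
Proof.
case: d c => [q p psi h] [r q' phi g] [/= s1 [t1 [d1 c1]]] [/= s2 [t2 [d2 c2]]] eq; subst q'.
by split=> /=; [|split; [|split]]; ty.
Qed.

Lemma act_ok2_id c : ok1 c -> ok2 (act_id2 c).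
Proof.
case: c => [q p psi h] ok; split=> //; split=> //; case: ok => /= s1 [t1 [d1 c1]].
do 2![split=> //]; split; [ty|split; [ty|]].
by rewrite act_id // -c1 gid_comp.
Qed.

Lemma act_ok2_vcomp e d : ok2 e -> ok2 d -> a_dom e = a_cod d -> ok2 (act_vcomp e d).
Proof.
case: e d => [c3 c2 phi] [c1 c2' psi] [/= ok_2 [ok_3 [s23 [t23 [dphi [cphi e23]]]]]].
case=> [/= ok_1 [_ [s12 [t12 [dpsi [cpsi e12]]]]]] e; subst c2'.
split=> //; split=> //; split; first by rewrite /= s12.
split; first by rewrite /= t12.
case: ok_1 ok_2 => s1 [t1 [d1 c1']] [_ [t3 _]].
split; [|split] => /=; [ty|ty|].
rewrite act_compr; try ty.
by rewrite -gcompA; ty.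
Qed.

(** Naturality of [kappa] moves the 2-cells past it, and bifunctoriality of the action then
    exchanges [psi] with [chi]. *)
Lemma act_ok2_hcomp e d : ok2 e -> ok2 d -> a_src (a_dom e) = a_tgt (a_dom d) ->
  ok2 (act_hcomp A e d).
Proof.
case: e d => [[q p psi h] [q' p' psi' h'] phi] [[r s xi g] [r' s' xi' g'] chi].
case=> [/= ok_e [ok_e' [s1 [t1 [dphi [cphi e1]]]]]]; subst q' p'.
case=> [/= ok_d [ok_d' [s2 [t2 [dchi [cchi e2]]]]]] e; subst r' s' q.
split; first exact: act_ok1_comp.
split; first exact: act_ok1_comp.
case: ok_e ok_d ok_e' ok_d' => [/= Ls [Lp [dpsi cpsi]]] [/= Lr [Ls' [dxi cxi]]].
move=> [/= Ls1 [Lp1 [dpsi' cpsi']]] [/= Lr1 [Ls1' [dxi' cxi']]].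
do 2![split=> //]; split; [|split] => /=; [ty|ty|].
rewrite -e1 -e2.
have := kappa_nat (a := gid p) (phi := phi) (psi := chi).
rewrite gdom_id gcod_id dphi dchi cphi cchi => k.
rewrite gcompA; try ty.
rewrite k; try ty.
rewrite -gcompA; try ty.
congr (_ ** _).
rewrite act_compl; try ty.
rewrite gcompA; try ty.
rewrite [RHS]gcompA; try ty.
congr (_ ** _).
rewrite -[RHS]gcompA; try ty.
have := act_split (a := psi) (phi := chi).
have := act_split' (a := psi) (phi := chi).
rewrite dpsi dchi cpsi cchi => E1 E2.
rewrite -E2; try ty.
rewrite E1; try ty.
rewrite gcompA; try ty.
congr (_ ** _).
have e3 : gdom (gid p <: phi) = p <| h by ty.
rewrite -e3 -cchi -act_split //; ty.
Qed.

(** Action axiom (i), after naturality of [kappa] in its first argument has moved [psi] out of the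
    way. *)
Lemma act_ok2_assoc e d c : ok1 e -> ok1 d -> ok1 c ->
  a_src e = a_tgt d -> a_src d = a_tgt c -> ok2 (act_assoc A e d c).
Proof.
move=> oke okd okc ed dc; split; first by do !apply: act_ok1_comp.
split; first by do !apply: act_ok1_comp.
case: e d c oke okd okc ed dc => [q p psi h] [r q' xi g] [s r' chi f] /=.
case=> [/= Lq [Lp [dpsi cpsi]]] [/= Lr [Lq' [dxi cxi]]] [/= Ls [Lr' [dchi cchi]]].
move=> eq er; subst q' r'.
do 2![split=> //]; split; [|split] => /=; [ty|ty|].
do 2![rewrite act_compl; try ty].
have := kappa_assoc (p := p) (f := h) (g := g) (h := f).
rewrite gcompA; try ty.
rewrite !gcompA; try ty.
move=> ->; try ty.
congr (_ ** _ ** _); rewrite -!gcompA; try ty.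
congr (_ ** _).
have := kappa_nat (a := psi) (phi := bid2 g) (psi := bid2 f).
have gf : bsrc g = btgt f by ty.
by rewrite !(bdom_id2 HB) !(bcod_id2 HB) dpsi cpsi (bhcomp_id HB gf) => ->.
Qed.

(** Action axiom (ii) produces [iota] acted on by the 1-cell, which cancels against the inverse
    coming from the identity 1-cell. *)
Lemma act_ok2_lunit c : ok1 c -> ok2 (act_lunit A c).
Proof.
move=> ok; split; first by apply: act_ok1_comp (act_ok1_id _) ok _.
split=> //; case: c ok => q p psi h [/= Lq [Lp [dpsi cpsi]]].
do 2![split=> //]; split; [|split] => /=; [ty|ty|].
rewrite gcompA; try ty.
rewrite kappa_lunit // gcompA; try ty.
rewrite -act_compl; try ty.
by rewrite gcomp_inv gcod_iota act_id // -cpsi gid_comp.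
Qed.

(** Action axiom (iii) produces [iota] at [p <| h]; naturality carries it across [psi] to cancel the
    inverse at the source. *)
Lemma act_ok2_runit c : ok1 c -> ok2 (act_runit A c).
Proof.
move=> ok; split; first by apply: act_ok1_comp ok (act_ok1_id _) _.
split=> //; case: c ok => q p psi h [/= Lq [Lp [dpsi cpsi]]].
do 2![split=> //]; split; [|split] => /=; [ty|ty|].
rewrite gcompA; try ty.
rewrite Lq kappa_runit // gcompA; try ty.
have := iota_nat psi; rewrite dpsi cpsi Lq => <-.
rewrite -gcompA; try ty.
by rewrite gcomp_inv gcod_iota -dpsi gcomp_id.
Qed.

(** Cancelling [a_mor c] in the defining equation determines [gid p <: phi], hence [phi] by
    faithfulness. *)
Lemma act_ok2_unique g g' : ok2 g -> ok2 g' ->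
  a_dom g = a_dom g' -> a_cod g = a_cod g' -> g = g'.
Proof.
case: g g' => [c d phi] [c' d' phi'] /= ok ok' ec ed; subst c' d'.
case: ok ok' => /= ok_c [ok_d [_ [t [dphi [cphi e]]]]] [/= _ [_ [_ [_ [dphi' [cphi' e']]]]]].
case: ok_c ok_d => s1 [t1 [d1 c1]] [s2 [t2 [d2 c2]]].
congr Act2; apply: (@act2_inj (a_tgt c) (a_cell c) (a_cell d)) => //; first by rewrite t.
by apply: (gcomp_injr (a := a_mor c)); ty.
Qed.

Lemma act_ok2_exists c d : ok1 c -> ok1 d -> a_src c = a_src d -> a_tgt c = a_tgt d ->
  exists phi, ok2 (Act2 c d phi).
Proof.
case: c d => [q p psi h] [q' p' xi l] ok_c ok_d /= eq ep; subst q' p'.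
have [/= s1 [t1 [d1 c1]]] := ok_c; have [/= s2 [t2 [d2 c2]]] := ok_d.
(* The equation [(p <| phi) psi = xi] forces [phi] to lie over [xi ** ginv psi]. *)
have [||phi [dphi [cphi e]]] := @act2_full p h l (xi ** ginv psi) t1 t2; try ty.
exists phi; do 6![split=> //=]; rewrite e -gcompA; try ty.
by rewrite ginv_comp d1 -d2 gcomp_id.
Qed.

Lemma gcomp_solve k phi xi : gcod xi = gcod k -> gdom xi = gdom phi ->
  exists b : gMor P, gdom b = gcod phi /\ gcod b = gdom k /\ k ** (b ** phi) = xi.
Proof.
move=> ec ed; exists (ginv k ** (xi ** ginv phi)); split; [ty|split; [ty|]].
rewrite !gcompA; try ty.
rewrite gcomp_inv -ec gid_comp -gcompA; try ty.
by rewrite ginv_comp -ed gcomp_id.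
Qed.

(** * Solving the triangle equation for one of its edges *)

Section Triangles.
Variables (p0 p1 p2 : gOb P) (h01 h12 h02 : b1 B) (gamma : b2 B).
Hypotheses (L0 : L p0 = bsrc h01) (L1 : L p1 = btgt h01).
Hypotheses (L1' : L p1 = bsrc h12) (L2 : L p2 = btgt h12).
Hypotheses (dg : bdom gamma = bcomp1 h12 h01) (cg : bcod gamma = h02).

Local Notation triangle psi01 psi12 psi02 :=
  (ok2 (Act2 (comp1 (Act1 p1 p2 psi12 h12) (Act1 p0 p1 psi01 h01))
             (Act1 p0 p2 psi02 h02) gamma)).

Let L0' : L p0 = bsrc h02. Proof. rewrite -cg; ty. Qed.
Let L2' : L p2 = btgt h02. Proof. rewrite -cg; ty. Qed.

(** The factor depending only on the 1-cells and [gamma] is bracketed apart, giving the shape that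
    [gcomp_solve] handles. *)
Let triangleP psi01 psi12 psi02 :
  gdom psi01 = p0 -> gcod psi01 = p1 <| h01 ->
  gdom psi12 = p1 -> gcod psi12 = p2 <| h12 ->
  ((gid p2 <: gamma) ** kappa A p2 h12 h01) ** ((psi12 <: bid2 h01) ** psi01) = psi02 ->
  triangle psi01 psi12 psi02.
Proof.
move=> d01 c01 d12 c12 <-.
split; first by apply: act_ok1_comp; do 3?split; ty.
split; first by split; [|split; [|split]] => /=; ty.
by do 4![split=> //=]; rewrite !gcompA; ty.
Qed.

Let triangle_eq psi01 psi12 psi02 : triangle psi01 psi12 psi02 ->
  ok1 (Act1 p0 p1 psi01 h01) -> ok1 (Act1 p1 p2 psi12 h12) ->
  ((gid p2 <: gamma) ** kappa A p2 h12 h01) ** ((psi12 <: bid2 h01) ** psi01) = psi02.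
Proof.
move=> [_ [_ [_ [_ [_ [_ /= <-]]]]]] [/= _ [_ [d01 c01]]] [/= _ [_ [d12 c12]]].
by rewrite !gcompA; ty.
Qed.

Lemma triangle_exists02 psi01 psi12 :
  ok1 (Act1 p0 p1 psi01 h01) -> ok1 (Act1 p1 p2 psi12 h12) ->
  exists psi02, triangle psi01 psi12 psi02.
Proof.
move=> [/= _ [_ [d01 c01]]] [/= _ [_ [d12 c12]]].
by eexists; apply: triangleP.
Qed.

Lemma triangle_exists12 psi01 psi02 :
  ok1 (Act1 p0 p1 psi01 h01) -> ok1 (Act1 p0 p2 psi02 h02) ->
  exists psi12, ok1 (Act1 p1 p2 psi12 h12) /\ triangle psi01 psi12 psi02.
Proof.
move=> [/= _ [_ [d01 c01]]] [/= _ [_ [d02 c02]]].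
have [||b [db [cb eb]]] :=
  @gcomp_solve ((gid p2 <: gamma) ** kappa A p2 h12 h01) psi01 psi02; try ty.
have [||||psi12 [d12 [c12 e]]] := @act_full p1 (p2 <| h12) h01 b; try ty.
exists psi12; split; first by do 3?split.
by apply: triangleP => //; rewrite e.
Qed.

Lemma triangle_exists01 psi12 psi02 :
  ok1 (Act1 p1 p2 psi12 h12) -> ok1 (Act1 p0 p2 psi02 h02) ->
  exists psi01, ok1 (Act1 p0 p1 psi01 h01) /\ triangle psi01 psi12 psi02.
Proof.
move=> [/= _ [_ [d12 c12]]] [/= _ [_ [d02 c02]]].
(* With [gid p0] as right factor, the morphism solved for is [psi01] itself. *)
have [||psi01 [d01 [c01 e]]] := @gcomp_solve
  (((gid p2 <: gamma) ** kappa A p2 h12 h01) ** (psi12 <: bid2 h01)) (gid p0) psi02; try ty.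
move: d01 c01 e; rewrite gcod_id => d01 c01.
rewrite -{1}d01 gcomp_id -gcompA; try ty.
move=> e; exists psi01; split; first by do 3?split=> //=; ty.
by apply: triangleP => //; ty.
Qed.

Lemma triangle_unique12 psi01 psi12 psi12' psi02 :
  ok1 (Act1 p0 p1 psi01 h01) -> ok1 (Act1 p1 p2 psi12 h12) ->
  ok1 (Act1 p1 p2 psi12' h12) ->
  triangle psi01 psi12 psi02 -> triangle psi01 psi12' psi02 -> psi12 = psi12'.
Proof.
move=> ok01 ok12 ok12' /triangle_eq/(_ ok01 ok12) e /triangle_eq/(_ ok01 ok12').
case: ok01 ok12 ok12' => [/= _ [_ [d01 c01]]] [/= _ [_ [d12 c12]]] [/= _ [_ [d12' c12']]].
rewrite -{}e => e; apply: (act_faithful (f := h01)); try ty.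
apply: (gcomp_injr (a := psi01)); try ty.
by apply: gcomp_injl (esym e); ty.
Qed.

Lemma triangle_unique01 psi01 psi01' psi12 psi02 :
  ok1 (Act1 p0 p1 psi01 h01) -> ok1 (Act1 p0 p1 psi01' h01) ->
  ok1 (Act1 p1 p2 psi12 h12) ->
  triangle psi01 psi12 psi02 -> triangle psi01' psi12 psi02 -> psi01 = psi01'.
Proof.
move=> ok01 ok01' ok12 /triangle_eq/(_ ok01 ok12) e /triangle_eq/(_ ok01' ok12).
case: ok01 ok01' ok12 => [/= _ [_ [d01 c01]]] [/= _ [_ [d01' c01']]] [/= _ [_ [d12 c12]]].
rewrite -{}e => e; apply: (gcomp_injl (b := psi12 <: bid2 h01)); try ty.
by apply: gcomp_injl (esym e); ty.
Qed.

End Triangles.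

(* Whiskering in [B] is faithful because [gid p <: (id * phi)] is conjugate to
   [gid (p <| f) <: phi] by [kappa], and similarly on the other side. *)
Lemma whiskerl_inj p f g h phi phi' : L p = btgt f -> bsrc f = btgt g ->
  bdom phi = g -> bcod phi = h -> bdom phi' = g -> bcod phi' = h ->
  bhcomp (bid2 f) phi = bhcomp (bid2 f) phi' -> phi = phi'.
Proof.
move=> Lf sf dphi cphi dphi' cphi' e.
have th : btgt h = btgt g by rewrite -cphi; ty.
apply: (@act2_inj (p <| f) g h) => //; try ty.
rewrite -act_id //.
have := kappa_nat (a := gid p) (phi := bid2 f) (psi := phi).
have := kappa_nat (a := gid p) (phi := bid2 f) (psi := phi').
rewrite gdom_id gcod_id (bdom_id2 HB) (bcod_id2 HB) dphi dphi' cphi cphi' -e.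
move=> E1 E2; apply: (gcomp_injl (b := kappa A p f h)); try ty.
by rewrite -E1 // -E2.
Qed.

Lemma whiskerr_inj p f g h phi phi' : L p = btgt g -> bsrc g = btgt f ->
  bdom phi = g -> bcod phi = h -> bdom phi' = g -> bcod phi' = h ->
  bhcomp phi (bid2 f) = bhcomp phi' (bid2 f) -> phi = phi'.
Proof.
move=> Lg sg dphi cphi dphi' cphi' e.
have th : btgt h = btgt g by rewrite -cphi; ty.
have sh : bsrc h = bsrc g by rewrite -cphi; ty.
apply: (@act2_inj p g h) => //; try ty.
apply: (@act_faithful _ _ f); try ty.
have := kappa_nat (a := gid p) (phi := phi) (psi := bid2 f).
have := kappa_nat (a := gid p) (phi := phi') (psi := bid2 f).
rewrite gdom_id gcod_id (bdom_id2 HB) (bcod_id2 HB) dphi dphi' cphi cphi' -e.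
move=> E1 E2; apply: (gcomp_injl (b := kappa A p h f)); try ty.
by rewrite -E1 // -E2.
Qed.

(** * The nerve of the action bicategory *)

Local Notation D := (ActionBicat A).

(** Any 2-cell in the opposite direction is an inverse, both composites being identities by
    uniqueness. *)
Lemma act_iso2 (g : act2 P B) : ok2 g -> @iso2 D g.
Proof.
case: g => c d phi ok; have [/= okc [okd [s [t _]]]] := ok.
have [psi ok'] := act_ok2_exists okd okc (esym s) (esym t).
exists (Act2 d c psi); do 3![split=> //].
by split; apply: act_ok2_unique => //; first [exact: act_ok2_vcomp | exact: (act_ok2_id)].
Qed.

Lemma nerve_act_ext n (x x' : simplex D n) : is_nerve_simplex x -> is_nerve_simplex x' ->
  (forall i, sob x i = sob x' i) -> (forall i j h, sar x i j h = sar x' i j h) -> x = x'.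
Proof.
move=> [_ [_ [ce _]]] [_ [_ [ce' _]]] eo ea; apply: simplex_ext => // i j k h1 h2.
have [ok [d [c _]]] := ce i j k h1 h2; have [ok' [d' [c' _]]] := ce' i j k h1 h2.
by apply: act_ok2_unique => //; rewrite ?[LHS]d ?[RHS]d' ?[LHS]c ?[RHS]c' !ea.
Qed.

(** The 2-cells are picked by choice from a bare existence statement; the unit and cocycle equations
    hold because their sides are parallel well-formed 2-cells. *)
Lemma nerve_act_build n (p : 'I_n.+1 -> gOb P) (e : forall i j : 'I_n.+1, i <= j -> act1 P B) :
  (forall i j h, ok1 (e i j h) /\ a_src (e i j h) = p i /\ a_tgt (e i j h) = p j) ->
  (forall i, e i i (leqnn i) = act_id1 A (p i)) ->
  exists x : simplex D n, is_nerve_simplex x /\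
    (forall i, sob x i = p i) /\ (forall i j h, sar x i j h = e i j h).
Proof.
move=> ok_e e_id.
have ok_comp i j k h1 h2 : ok1 (act_comp1 A (e j k h2) (e i j h1)).
  have [[ok [_ t]] [ok' [s _]]] := (ok_e i j h1, ok_e j k h2).
  by apply: act_ok1_comp => //; rewrite s.
have tri i j k h1 h2 :
    exists phi, ok2 (Act2 (act_comp1 A (e j k h2) (e i j h1)) (e i k (leq_trans h1 h2)) phi).
  have [[ok [s t]] [ok' [s' t']]] := (ok_e i j h1, ok_e j k h2).
  have [ok2 [s2 t2]] := ok_e i k (leq_trans h1 h2).
  by apply: act_ok2_exists => //=; rewrite ?s ?s2 ?t' ?t2.
pose c i j k h1 h2 := Act2 (act_comp1 A (e j k h2) (e i j h1)) (e i k (leq_trans h1 h2))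
  (proj1_sig (constructive_indefinite_description _ (tri i j k h1 h2))).
have ok_c i j k h1 h2 : ok2 (c i j k h1 h2).
  by rewrite /c; case: constructive_indefinite_description.
have e_irr i j h h' : e i j h = e i j h' by rewrite (bool_irrelevance h h').
exists (@Simplex D n p e c).
split; [split=> //; split=> //; split|by split].
- move=> i j k h1 h2; have ok := ok_c i j k h1 h2.
  by split=> //; split=> //; split=> //; apply: act_iso2.
split.
  move=> i j h; have [ok [s t]] := ok_e i j h.
  by apply: (act_ok2_unique (ok_c _ _ _ _ _) (act_ok2_runit ok)); rewrite /= ?/c /= ?e_id ?s.
split.
  move=> i j h; have [ok [s t]] := ok_e i j h.
  by apply: (act_ok2_unique (ok_c _ _ _ _ _) (act_ok2_lunit ok)); rewrite /= ?/c /= ?e_id ?t.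
move=> i j k l h1 h2 h3 /=.
have [[oij [sij tij]] [ojk [sjk tjk]]] := (ok_e i j h1, ok_e j k h2).
have [okl [skl tkl]] := ok_e k l h3.
apply: act_ok2_unique => //=.
- apply: act_ok2_vcomp => //=.
  apply: act_ok2_vcomp => //=.
    apply: act_ok2_hcomp => //=; first exact: act_ok2_id.
    by rewrite skl.
  by apply: act_ok2_assoc; rewrite ?skl ?sjk.
- apply: act_ok2_vcomp => //=.
    apply: act_ok2_hcomp => //=.
      exact: act_ok2_id.
    by rewrite sjk.
Qed.

(** * Gluing compatible faces *)

Section Gluing.
Variables (m : nat) (S : pred nat) (y : nat -> simplex D m.+1).
Hypothesis avoid : forall i j : 'I_m.+3, exists l : 'I_m.+3, [/\ S l, i != l & j != l].
Hypothesis nerve_y : forall i, i <= m.+2 -> S i -> is_nerve_simplex (y i).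
Hypothesis compat : forall i j, i < j -> j <= m.+2 -> S i -> S j ->
  face i (y j) = face j.-1 (y i).

(** By [avoid] any two vertices lie in a common given face, so the given faces supply all edges. *)
Lemma nerve_act_glue : exists x : simplex D m.+2, is_nerve_simplex x /\
  (forall i, i <= m.+2 -> S i -> face i x = y i).
Proof.
(* Quantifying over all given faces through [i] and [j] records that the edge does not depend on the
   face chosen. *)
have edge (i j : 'I_m.+3) (h : i <= j) : exists v, forall (l : 'I_m.+3) a b h',
    S l -> lift l a = i -> lift l b = j -> sar (y l) a b h' = v.
  have [l [Sl il jl]] := avoid i j.
  have [[a ea] [b eb]] := (lift_preimage il, lift_preimage jl).
  have h' : a <= b by move: h; rewrite -ea -eb leq_bump2.
  exists (sar (y l) a b h') => l' a' b' h'' Sl' ea' eb'.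
  by apply: (glue_sar compat) => //; rewrite ?ea' ?eb'.
pose e i j h := proj1_sig (constructive_indefinite_description _ (edge i j h)).
have eP (l : 'I_m.+3) a b h h' : S l -> e (lift l a) (lift l b) h = sar (y l) a b h'.
  by move=> Sl; rewrite (proj2_sig (constructive_indefinite_description _ (edge _ _ h)) l a b h').
(* Vertices are read off the diagonal edges and so need no gluing argument of their own. *)
pose p i := a_src (e i i (leqnn i)).
have nerve_l (l : 'I_m.+3) : S l -> is_nerve_simplex (y l).
  by move=> Sl; apply: nerve_y => //; rewrite -ltnS.
have pP (l : 'I_m.+3) a : S l -> p (lift l a) = sob (y l) a.
  move=> Sl; rewrite /p (eP l a a _ (leqnn a)) //.
  by have [ar _] := nerve_l l Sl; have [_ [s _]] := ar a a (leqnn a); exact: s.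
have [||x [nerve_x [xo xa]]] := @nerve_act_build _ p e.
- move=> i j h; have [l [Sl il jl]] := avoid i j.
  have [[a ea] [b eb]] := (lift_preimage il, lift_preimage jl); subst.
  have h' : a <= b by move: h; rewrite leq_bump2.
  by rewrite (eP _ _ _ _ h') // !pP //; have [ar _] := nerve_l l Sl; apply: ar.
- move=> i; have [l [Sl il _]] := avoid i i.
  have [a ea] := lift_preimage il; subst.
  by rewrite (eP _ _ _ _ (leqnn a)) // pP //; have [_ [u _]] := nerve_l l Sl; apply: u.
exists x; split=> // i lt_i Si.
have iE : val (inord i : 'I_m.+3) = i by rewrite /= inordK.
apply: nerve_act_ext; first exact: nerve_precomp.
- exact: nerve_y.
- by move=> a /=; rewrite xo pP iE.
- by move=> a b h /=; rewrite xa (eP _ _ _ _ h) iE.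
Qed.

End Gluing.

Local Notation F := (ActionProjection A).

Lemma nerve_act_proj n (x : simplex D n) : is_nerve_simplex x -> is_nerve_simplex (nerve_map F x).
Proof.
move=> [ar [unit_ [ce [lun [run coc]]]]].
have b2iso (a : b2 B) : @iso2 (bicat_data B) a by have [b ?] := b2_iso HB a; exists b.
split.
  move=> i j h; have [[/= Ls [Lt _]] [s t]] := ar i j h.
  by split=> //; rewrite -s -t.
split; first by move=> i /=; rewrite unit_.
split.
  move=> i j k h1 h2; have [ok [d [c _]]] := ce i j k h1 h2.
  have [_ [_ [_ [_ [dd [cc _]]]]]] := ok.
  split=> //; split; first by rewrite [LHS]dd; apply: (congr1 (@a_cell P B) d).
  by split; [rewrite [LHS]cc; apply: (congr1 (@a_cell P B) c)|].
split; first by move=> i j h /=; rewrite lun.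
split; first by move=> i j h /=; rewrite run.
by move=> i j k l h1 h2 h3 /=; have /(congr1 (@a_2 P B)) := coc i j k l h1 h2 h3.
Qed.

(** * Three faces of a tetrahedron in the base determine the fourth *)

Section Tetrahedron.
Variables (n : nat) (w z : simplex (bicat_data B) n).
Hypotheses (nerve_w : is_nerve_simplex w) (nerve_z : is_nerve_simplex z).
Hypothesis eq_sar : forall i j h, sar w i j h = sar z i j h.
Variables (i j k l : 'I_n.+1) (h1 : i <= j) (h2 : j <= k) (h3 : k <= l).

Let sce_dc a b c g1 g2 :
  [/\ bdom (sce w a b c g1 g2) = bcomp1 (sar z b c g2) (sar z a b g1),
      bcod (sce w a b c g1 g2) = sar z a c (leq_trans g1 g2),
      bdom (sce z a b c g1 g2) = bcomp1 (sar z b c g2) (sar z a b g1) &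
      bcod (sce z a b c g1 g2) = sar z a c (leq_trans g1 g2)].
Proof.
have [_ [_ [/(_ a b c g1 g2) [_ [dw [cw _]]] _]]] := nerve_w.
have [_ [_ [/(_ a b c g1 g2) [_ [dz [cz _]]] _]]] := nerve_z.
by split=> //; rewrite ?[LHS]dw ?[LHS]cw !eq_sar.
Qed.

Let sar_st a b g : bsrc (sar z a b g) = sob z a /\ btgt (sar z a b g) = sob z b.
Proof. by have [/(_ a b g) [_ ?] _] := nerve_z. Qed.

Local Notation ijk x := (sce x i j k h1 h2).
Local Notation ikl x := (sce x i k l (leq_trans h1 h2) h3).
Local Notation ijl x := (sce x i j l h1 (leq_trans h2 h3)).
Local Notation jkl x := (sce x j k l h2 h3).
Local Notation lhs x := (bvcomp (bhcomp (bid2 (sar z k l h3)) (ijk x))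
  (bassoc (sar z k l h3) (sar z j k h2) (sar z i j h1))).
Local Notation rhs x := (bhcomp (jkl x) (bid2 (sar z i j h1))).

(** In this grouping [ikl] and [ijl] stand outermost and cancel by invertibility, while [ijk] and
    [jkl] occur whiskered inside [lhs] and [rhs]. *)
Let cocycle : bvcomp (ikl w) (lhs w) = bvcomp (ijl w) (rhs w) /\
              bvcomp (ikl z) (lhs z) = bvcomp (ijl z) (rhs z).
Proof.
have [_ [_ [_ [_ [_ cw]]]]] := nerve_w; have [_ [_ [_ [_ [_ cz]]]]] := nerve_z.
by split; [have := cw i j k l h1 h2 h3 | have := cz i j k l h1 h2 h3]; rewrite ?eq_sar.
Qed.

Ltac facts :=
  have [eq_w eq_z] := cocycle;
  have [d1 c1 d1' c1'] := sce_dc h1 h2;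
  have [d2 c2 d2' c2'] := sce_dc (leq_trans h1 h2) h3;
  have [d3 c3 d3' c3'] := sce_dc h1 (leq_trans h2 h3);
  have [d4 c4 d4' c4'] := sce_dc h2 h3;
  have [s1 t1] := sar_st h1; have [s2 t2] := sar_st h2; have [s3 t3] := sar_st h3;
  have [s4 t4] := sar_st (leq_trans h1 h2); have [s5 t5] := sar_st (leq_trans h2 h3);
  have [s6 t6] := sar_st (leq_trans (leq_trans h1 h2) h3).

Lemma tetra_ikl : ijk w = ijk z -> ijl w = ijl z -> jkl w = jkl z -> ikl w = ikl z.
Proof.
facts => e1 e3 e4; apply: (bvcomp_injr HB (a := lhs z)); ty.
Qed.

Lemma tetra_ijl : ijk w = ijk z -> ikl w = ikl z -> jkl w = jkl z -> ijl w = ijl z.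
Proof.
facts => e1 e3 e4; apply: (bvcomp_injr HB (a := rhs z)); ty.
Qed.

(** Cancelling [ikl] and the associator leaves [ijk] whiskered by the edge [kl]; an object over the
    vertex [l] then makes [whiskerl_inj] applicable. *)
Lemma tetra_ijk : ikl w = ikl z -> ijl w = ijl z -> jkl w = jkl z -> ijk w = ijk z.
Proof.
facts => e1 e3 e4; have [p Lp] := mom_surj (sob z l).
apply: (whiskerl_inj (p := p) (f := sar z k l h3)); rewrite ?d1 ?c1 //; try ty.
apply: (bvcomp_injr HB (a := bassoc (sar z k l h3) (sar z j k h2) (sar z i j h1))); try ty.
by apply: (bvcomp_injl HB (b := ikl z)); rewrite ?eq_z -?e1 -?e3 -?e4 //; ty.
Qed.

Lemma tetra_jkl : ijk w = ijk z -> ikl w = ikl z -> ijl w = ijl z -> jkl w = jkl z.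
Proof.
facts => e1 e3 e4; have [p Lp] := mom_surj (sob z l).
apply: (whiskerr_inj (p := p) (f := sar z i j h1)); rewrite ?d4 ?c4 //; try ty.
by apply: (bvcomp_injl HB (b := ijl z)); rewrite -?eq_z -?e1 -?e3 -?e4 //; ty.
Qed.

End Tetrahedron.

(** * Boundaries, and the fibration property in dimension at least 3 *)

Lemma nerve_act_boundary_injective m : @boundary_injective D m.
Proof.
move=> x x' nx nx' eq_f.
have eq_face (l : 'I_m.+3) : face l x = face l x' by apply: eq_f; rewrite -ltnS.
apply: nerve_act_ext => // [i|i j h].
  have [|l] := @ord_avoid m.+3 [:: i] => //; rewrite inE eq_sym => il.
  exact: sob_face (eq_face l) _ il.
have [|l] := @ord_avoid m.+3 [:: i; j] => //.
rewrite !inE negb_or !(eq_sym l) => /andP[il jl].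
exact: sar_face (eq_face l) _ _ _ il jl.
Qed.

Lemma nerve_act_boundary_surjective m : @boundary_surjective D m.
Proof.
move=> y nerve_y compat.
have [||i j lt_ij le_j _ _|x [nx fx]] := @nerve_act_glue m predT y; last by exists x; auto.
- move=> i j; have [|l] := @ord_avoid m.+3 [:: i; j] => //.
  by rewrite !inE negb_or !(eq_sym l) => /andP[il jl]; exists l.
- by move=> i le_i _; apply: nerve_y.
- exact: compat.
Qed.

Lemma nerve_act_exact_fibration_ge3 m : exact_fibration_in_dim F m.+1.
Proof.
move=> k le_k; pose K : 'I_m.+4 := inord k.
have KE : val K = k by rewrite /= inordK.
have neqK (l : 'I_m.+4) : (val l != k) = (l != K) by rewrite -KE.
split=> [x x' nx nx' eq_f _ | y nerve_y compat z nz fz].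
  have eq_face l : l != K -> face l x = face l x'.
    by rewrite -neqK => lk; apply: eq_f => //; rewrite -ltnS.
  apply: nerve_act_ext => // [i|i j h].
    have [|l] := @ord_avoid m.+4 [:: i; K] => //.
    rewrite !inE negb_or (eq_sym l i) => /andP[il lK].
    exact: sob_face (eq_face l lK) _ il.
  have [|l] := @ord_avoid m.+4 [:: i; j; K] => //.
  rewrite !inE !negb_or (eq_sym l i) (eq_sym l j) => /and3P[il jl lK].
  exact: sar_face (eq_face l lK) _ _ _ il jl.
have [||i j lt_ij le_j|x [nx fx]] := @nerve_act_glue m.+1 (fun l => l != k) y.
- move=> i j; have [|l] := @ord_avoid m.+4 [:: i; j; K] => //.
  by rewrite !inE !negb_or !(eq_sym l i) !(eq_sym l j) -neqK => /and3P[il jl lK]; exists l.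
- exact: nerve_y.
- exact: compat.
exists x; split=> //; split=> //.
have eq_face l : l != K -> face l (nerve_map F x) = face l z.
  rewrite -neqK => lk; have le_l : l <= m.+3 by rewrite -ltnS.
  (* Faces commute with [nerve_map] by computation. *)
  by rewrite fz // -fx.
have eq_sob i : sob (nerve_map F x) i = sob z i.
  have [|l] := @ord_avoid m.+4 [:: i; K] => //.
  rewrite !inE negb_or (eq_sym l i) => /andP[il lK].
  exact: sob_face (eq_face l lK) _ il.
have eq_sar i j h : sar (nerve_map F x) i j h = sar z i j h.
  have [|l] := @ord_avoid m.+4 [:: i; j; K] => //.
  rewrite !inE !negb_or (eq_sym l i) (eq_sym l j) => /and3P[il jl lK].
  exact: sar_face (eq_face l lK) _ _ _ il jl.
have nw := nerve_act_proj nx.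
move: (nerve_map F x) nw eq_face eq_sob eq_sar => w nw eq_face eq_sob eq_sar.
have eq_sce a b c g1 g2 d : d != K -> d \notin [:: a; b; c] ->
    sce w a b c g1 g2 = sce z a b c g1 g2.
  move=> dK; rewrite !inE !negb_or !(eq_sym d) => /and3P[ad bd cd].
  exact: sce_face (eq_face d dK) _ _ _ _ _ ad bd cd.
apply: simplex_ext => // a b c g1 g2.
(* If two of [a], [b], [c], [K] coincide, at most three vertices are excluded out of at least four,
   so some given face contains the triangle. *)
have [|not_uniq] := boolP (uniq [:: a; b; c; K]); last first.
  have [|d] := @ord_avoid m.+4 (undup [:: a; b; c; K]).
    by rewrite (leq_trans (n := 4)) // ltn_size_undup.
  rewrite mem_undup -[[:: a; b; c; K]]/([:: a; b; c] ++ [:: K]) mem_cat negb_or mem_seq1.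
  by case/andP=> d_abc dK; apply: eq_sce dK d_abc.
rewrite /= !inE !negb_or !andbT -!val_eqE /= => /and3P[/and3P[ab ac aK] /andP[bc bK] cK].
(* Inserting [K] into [a < b < c] gives a tetrahedron whose three faces through [K] each lie in a
   given face; the position of [K] decides which tetrahedron lemma yields the face opposite to
   it. *)
have [lt_aK|lt_Ka|e] := ltngtP a K; last by rewrite e eqxx in aK.
  have [lt_bK|lt_Kb|e] := ltngtP b K; last by rewrite e eqxx in bK.
    have [lt_cK|lt_Kc|e] := ltngtP c K; last by rewrite e eqxx in cK.
      apply: (tetra_ijk nw nz eq_sar (h3 := ltnW lt_cK)).
      - by apply: (eq_sce _ _ _ _ _ b); rewrite // !inE -!val_eqE /=; lia.
      - by apply: (eq_sce _ _ _ _ _ c); rewrite // !inE -!val_eqE /=; lia.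
      - by apply: (eq_sce _ _ _ _ _ a); rewrite // !inE -!val_eqE /=; lia.
    rewrite (sce_irr w _ g2 g1 (leq_trans (ltnW lt_bK) (ltnW lt_Kc))) //.
    rewrite (sce_irr z _ g2 g1 (leq_trans (ltnW lt_bK) (ltnW lt_Kc))) //.
    apply: (tetra_ijl nw nz eq_sar).
    - by apply: (eq_sce _ _ _ _ _ c); rewrite // !inE -!val_eqE /=; lia.
    - by apply: (eq_sce _ _ _ _ _ b); rewrite // !inE -!val_eqE /=; lia.
    - by apply: (eq_sce _ _ _ _ _ a); rewrite // !inE -!val_eqE /=; lia.
  rewrite (sce_irr w g1 g2 (leq_trans (ltnW lt_aK) (ltnW lt_Kb)) g2) //.
  rewrite (sce_irr z g1 g2 (leq_trans (ltnW lt_aK) (ltnW lt_Kb)) g2) //.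
  apply: (tetra_ikl nw nz eq_sar).
  - by apply: (eq_sce _ _ _ _ _ c); rewrite // !inE -!val_eqE /=; lia.
  - by apply: (eq_sce _ _ _ _ _ b); rewrite // !inE -!val_eqE /=; lia.
  - by apply: (eq_sce _ _ _ _ _ a); rewrite // !inE -!val_eqE /=; lia.
apply: (tetra_jkl nw nz eq_sar (h1 := ltnW lt_Ka)).
- by apply: (eq_sce _ _ _ _ _ c); rewrite // !inE -!val_eqE /=; lia.
- by apply: (eq_sce _ _ _ _ _ a); rewrite // !inE -!val_eqE /=; lia.
- by apply: (eq_sce _ _ _ _ _ b); rewrite // !inE -!val_eqE /=; lia.
Qed.

(** * Simplices of dimension at most 2 from nondegenerate edges *)

Lemma nerve_act_ext_lt n (x x' : simplex D n) : is_nerve_simplex x -> is_nerve_simplex x' ->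
  (forall i, sob x i = sob x' i) ->
  (forall (i j : 'I_n.+1) h, i < j -> sar x i j h = sar x' i j h) -> x = x'.
Proof.
move=> nx nx' eo ea; apply: nerve_act_ext => // i j h; have := h.
rewrite leq_eqVlt => /orP[/eqP/val_inj e|]; last exact: ea.
have [[_ [u _]] [_ [u' _]]] := (nx, nx'); subst j.
by rewrite (bool_irrelevance h (leqnn i)) u u' eo.
Qed.

(** Identities overwrite [e] on the diagonal. As [e] takes no proof of an inequality, it can be
    given by tests on the indices. *)
Lemma nerve_act_build_lt n (p : 'I_n.+1 -> gOb P) (e : 'I_n.+1 -> 'I_n.+1 -> act1 P B) :
  (forall i j : 'I_n.+1, i < j -> ok1 (e i j) /\ a_src (e i j) = p i /\ a_tgt (e i j) = p j) ->
  exists x : simplex D n, is_nerve_simplex x /\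
    (forall i, sob x i = p i) /\ (forall (i j : 'I_n.+1) h, i < j -> sar x i j h = e i j).
Proof.
move=> ok_e.
have [||x [nx [xo xa]]] := @nerve_act_build n p
  (fun i j _ => if i == j then act_id1 A (p i) else e i j).
- move=> i j h; have [<-|ij] := eqVneq i j; first by split=> //; apply: act_ok1_id.
  by apply: ok_e; rewrite ltn_neqAle h andbT.
- by move=> i; rewrite eqxx.
exists x; split=> //; split=> // i j h lt_ij; rewrite xa.
by case: eqP lt_ij => // ->; rewrite ltnn.
Qed.

(** Inequalities between literal ordinals compute to [true], so [isT] proves them. *)
Local Notation e0 := (@Ordinal 2 0 isT).
Local Notation e1 := (@Ordinal 2 1 isT).
Local Notation v0 := (@Ordinal 3 0 isT).
Local Notation v1 := (@Ordinal 3 1 isT).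
Local Notation v2 := (@Ordinal 3 2 isT).

Lemma ord2P (i : 'I_2) : i = e0 \/ i = e1.
Proof. by case: i => [[|[|i]] hi] //; [left|right]; apply: val_inj. Qed.

Lemma ord3P (i : 'I_3) : [\/ i = v0, i = v1 | i = v2].
Proof.
by case: i => [[|[|[|i]]] hi] //; [apply: Or31|apply: Or32|apply: Or33]; apply: val_inj.
Qed.

Lemma nerve_act_edge_ext (x x' : simplex D 1) : is_nerve_simplex x -> is_nerve_simplex x' ->
  sar x e0 e1 isT = sar x' e0 e1 isT -> x = x'.
Proof.
move=> nx nx' e; apply: nerve_act_ext_lt => // [i|i j h].
  have [[/(_ e0 e1 isT) [_ [s t]] _] [/(_ e0 e1 isT) [_ [s' t']] _]] := (nx, nx').
  by have [->|->] := ord2P i; rewrite -?s -?s' -?t -?t' e.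
have [ei|ei] := ord2P i; have [ej|ej] := ord2P j; subst => // _.
by rewrite (bool_irrelevance h isT).
Qed.

Lemma nerve_act_triangle_ext (x x' : simplex D 2) : is_nerve_simplex x -> is_nerve_simplex x' ->
  sar x v0 v1 isT = sar x' v0 v1 isT -> sar x v1 v2 isT = sar x' v1 v2 isT ->
  sar x v0 v2 isT = sar x' v0 v2 isT -> x = x'.
Proof.
move=> nx nx' e01 e12 e02; apply: nerve_act_ext_lt => // [i|i j h].
  have [[/(_ v0 v1 isT) [_ [s t]] _] [/(_ v0 v1 isT) [_ [s' t']] _]] := (nx, nx').
  have [[/(_ v1 v2 isT) [_ [_ r]] _] [/(_ v1 v2 isT) [_ [_ r']] _]] := (nx, nx').
  by have [->|->|->] := ord3P i; rewrite -?s -?s' -?t -?t' -?r -?r' ?e01 ?e12.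
have [ei|ei|ei] := ord3P i; have [ej|ej|ej] := ord3P j; subst => // _;
  by rewrite (bool_irrelevance h isT).
Qed.

Lemma nerve_act_edge (c : act1 P B) : ok1 c ->
  exists x : simplex D 1, [/\ is_nerve_simplex x, sob x e0 = a_src c, sob x e1 = a_tgt c &
    sar x e0 e1 isT = c].
Proof.
move=> ok.
have [|x [nx [xo xa]]] := @nerve_act_build_lt 1
  (fun i => if val i == 0 then a_src c else a_tgt c) (fun _ _ => c).
  by move=> i j; have [->|->] := ord2P i; have [->|->] := ord2P j.
by exists x; split=> //; rewrite ?xo ?xa.
Qed.

(** The edges determine [x]. Uniqueness identifies its nondegenerate 2-cell with the one over [z],
    and normality settles the degenerate ones. *)
Lemma nerve_act_triangle (c01 c12 c02 : act1 P B) (z : simplex (bicat_data B) 2) :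
  is_nerve_simplex z -> ok1 c01 -> ok1 c12 -> ok1 c02 ->
  a_cell c01 = sar z v0 v1 isT -> a_cell c12 = sar z v1 v2 isT ->
  a_cell c02 = sar z v0 v2 isT -> a_src c02 = a_src c01 ->
  ok2 (Act2 (act_comp1 A c12 c01) c02 (sce z v0 v1 v2 isT isT)) -> a_tgt c01 = a_src c12 ->
  exists x : simplex D 2, [/\ is_nerve_simplex x, sar x v0 v1 isT = c01,
    sar x v1 v2 isT = c12, sar x v0 v2 isT = c02 & nerve_map F x = z].
Proof.
move=> nz ok01 ok12 ok02 h01 h12 h02 s0 ok_g t1.
have [_ [_ [_ [/= t2 _]]]] := ok_g.
have [|x [nx [xo xa]]] := @nerve_act_build_lt 2
  (fun i => if val i == 0 then a_src c01 else if val i == 1 then a_tgt c01 else a_tgt c12)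
  (fun i j => if val j == 1 then c01 else if val i == 0 then c02 else c12).
  by move=> i j; have [->|->|->] := ord3P i; have [->|->|->] := ord3P j.
have nw := nerve_act_proj nx.
exists x; split=> //; rewrite ?xa //.
have [ar [u [_ [lu [ru _]]]]] := nz; have [_ [u' [_ [lu' [ru' _]]]]] := nw.
have eq_sob i : sob (nerve_map F x) i = sob z i.
  have [_ [s01 t01]] := ar v0 v1 isT; have [_ [s12 t12]] := ar v1 v2 isT.
  have [[L0 [L1 _]] [_ [L2 _]]] := (ok01, ok12).
  by have [->|->|->] := ord3P i; rewrite /= xo /= ?L0 ?L1 ?L2 ?h01 ?h12.
have eq_sar i j h : sar (nerve_map F x) i j h = sar z i j h.
  have [eij|nij] := eqVneq i j.
    by subst j; rewrite (bool_irrelevance h (leqnn i)) u u' eq_sob.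
  have [ei|ei|ei] := ord3P i; have [ej|ej|ej] := ord3P j; subst => //;
    by rewrite (bool_irrelevance h isT) /= xa.
apply: simplex_ext => // i j k g1 g2.
have [eij|nij] := eqVneq i j.
  by subst j; rewrite (bool_irrelevance g1 (leqnn i)) lu lu' eq_sar.
have [ejk|njk] := eqVneq j k.
  by subst k; rewrite (bool_irrelevance g2 (leqnn j)) ru ru' eq_sar.
have [ei|ei|ei] := ord3P i; have [ej|ej|ej] := ord3P j; have [ek|ek|ek] := ord3P k; subst => //.
rewrite (bool_irrelevance g1 isT) (bool_irrelevance g2 isT) /=.
have [_ [_ [/(_ v0 v1 v2 isT isT) [ok [d [c _]]] _]]] := nx.
by rewrite (act_ok2_unique ok ok_g) //= ?[LHS]d ?[LHS]c ?xa.
Qed.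

(** * Two-dimensional horns: the missing edge 02, 12 or 01 is opposite the vertex 1, 0 or 2 *)

Lemma horn_exists02 c01 c12 g : ok1 c01 -> ok1 c12 -> a_tgt c01 = a_src c12 ->
  bdom g = bcomp1 (a_cell c12) (a_cell c01) ->
  exists c02, a_cell c02 = bcod g /\ ok2 (Act2 (act_comp1 A c12 c01) c02 g).
Proof.
case: c01 c12 => [p0 p1 psi h] [p1' p2 xi l] ok ok' /= e dg; subst p1'.
have [[/= L0 [L1 _]] [/= L1' [L2 _]]] := (ok, ok').
have [psi02 tri] := triangle_exists02 L0 L1 L1' L2 dg erefl ok ok'.
by exists (Act1 p0 p2 psi02 (bcod g)).
Qed.

Lemma horn_exists12 c01 c02 h12 g : ok1 c01 -> ok1 c02 -> a_src c01 = a_src c02 ->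
  mom A (a_tgt c01) = bsrc h12 -> mom A (a_tgt c02) = btgt h12 ->
  bdom g = bcomp1 h12 (a_cell c01) -> bcod g = a_cell c02 ->
  exists c12, [/\ ok1 c12, a_src c12 = a_tgt c01, a_cell c12 = h12 &
    ok2 (Act2 (act_comp1 A c12 c01) c02 g)].
Proof.
case: c01 c02 => [p0 p1 psi h] [p0' p2 xi l] ok ok' /= e L1' L2 dg cg; subst p0'.
have [/= L0 [L1 _]] := ok.
have [psi12 [ok12 tri]] := triangle_exists12 L0 L1 L1' L2 dg cg ok ok'.
by exists (Act1 p1 p2 psi12 h12).
Qed.

Lemma horn_exists01 c12 c02 h01 g : ok1 c12 -> ok1 c02 -> a_tgt c12 = a_tgt c02 ->
  mom A (a_src c02) = bsrc h01 -> mom A (a_src c12) = btgt h01 ->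
  bdom g = bcomp1 (a_cell c12) h01 -> bcod g = a_cell c02 ->
  exists c01, [/\ ok1 c01, a_tgt c01 = a_src c12, a_cell c01 = h01 &
    ok2 (Act2 (act_comp1 A c12 c01) c02 g)].
Proof.
case: c12 c02 => [p1 p2 psi h] [p0 p2' xi l] ok ok' /= e L0 L1 dg cg; subst p2'.
have [/= L1' [L2 _]] := ok.
have [psi01 [ok01 tri]] := triangle_exists01 L0 L1 L1' L2 dg cg ok ok'.
by exists (Act1 p0 p1 psi01 h01).
Qed.

Lemma horn_unique02 c01 c12 c02 c02' g : a_cell c02 = a_cell c02' ->
  ok2 (Act2 (act_comp1 A c12 c01) c02 g) -> ok2 (Act2 (act_comp1 A c12 c01) c02' g) ->
  c02 = c02'.
Proof.
case: c02 c02' => [p0 p2 psi h] [p0' p2' psi' h'] /= <-.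
case=> [_ [_ [/= s [t [_ [_ e]]]]]] [_ [_ [/= s' [t' [_ [_ e']]]]]].
by rewrite -s -s' -t -t' -e -e'.
Qed.

Lemma horn_unique12 c01 c12 c12' c02 g : ok1 c01 -> ok1 c12 -> ok1 c12' ->
  a_tgt c01 = a_src c12 -> a_src c12 = a_src c12' -> a_cell c12 = a_cell c12' ->
  ok2 (Act2 (act_comp1 A c12 c01) c02 g) -> ok2 (Act2 (act_comp1 A c12' c01) c02 g) ->
  c12 = c12'.
Proof.
case: c01 c12 c12' c02 => [p0 p1 psi01 h01] [q1 p2 psi12 h12] [q1' p2' psi12' h12']
  [p0' p2'' psi02 h02].
move=> ok01 ok12 ok12' /= e e' e'' tri tri'.
have [_ [_ [/= s [t [dg [cg _]]]]]] := tri; have [_ [_ [_ [/= t' _]]]] := tri'.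
subst q1 q1' h12' p0' p2 p2'.
congr Act1; have [[/= L0 [L1 _]] [/= L1' [L2 _]]] := (ok01, ok12).
exact: (triangle_unique12 L1 L1' L2 dg ok01 ok12 ok12' tri tri').
Qed.

Lemma horn_unique01 c01 c01' c12 c02 g : ok1 c01 -> ok1 c01' -> ok1 c12 ->
  a_tgt c01 = a_src c12 -> a_tgt c01 = a_tgt c01' -> a_cell c01 = a_cell c01' ->
  ok2 (Act2 (act_comp1 A c12 c01) c02 g) -> ok2 (Act2 (act_comp1 A c12 c01') c02 g) ->
  c01 = c01'.
Proof.
case: c01 c01' c12 c02 => [p0 p1 psi01 h01] [q0 q1 psi01' h01'] [q1' p2 psi12 h12]
  [p0' p2'' psi02 h02].
move=> ok01 ok01' ok12 /= e e' e'' tri tri'.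
have [_ [_ [/= s [t [dg [cg _]]]]]] := tri; have [_ [_ [/= s' _]]] := tri'.
subst q1 q1' h01' p0 q0 p2''.
congr Act1; have [[/= L0 [L1 _]] [/= L1' [L2 _]]] := (ok01, ok12).
exact: (triangle_unique01 L1 L1' L2 dg ok01 ok01' ok12 tri tri').
Qed.

(** Puts the 2-cell of a nerve simplex into the form with explicit edges that the horn lemmas
    expect. *)
Lemma nerve_ok_triangle (x : simplex D 2) : is_nerve_simplex x ->
  ok2 (Act2 (act_comp1 A (sar x v1 v2 isT) (sar x v0 v1 isT)) (sar x v0 v2 isT)
    (a_2 (sce x v0 v1 v2 isT isT))).
Proof.
move=> [_ [_ [/(_ v0 v1 v2 isT isT) [ok [d [c _]]] _]]].
rewrite (@sar_irr D 2 x v0 v2 v0 v2 _ isT) // in c.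
by rewrite -[X in Act2 X]d -[X in Act2 _ X]c; case: (sce x v0 v1 v2 isT isT) ok.
Qed.

Lemma nerve_act_horn2_unique k (x x' : simplex D 2) : k <= 2 ->
  is_nerve_simplex x -> is_nerve_simplex x' ->
  (forall i, i <= 2 -> i != k -> face i x = face i x') ->
  nerve_map F x = nerve_map F x' -> x = x'.
Proof.
move=> le_k nx nx' eq_f eq_F.
have eq_face (l : 'I_3) : val l != k -> face l x = face l x'.
  by move=> lk; apply: eq_f => //; rewrite -ltnS.
have [[ar _] [ar' _]] := (nx, nx').
have [ok01 [s01 t01]] := ar v0 v1 isT; have [ok12 [s12 t12]] := ar v1 v2 isT.
have [ok01' [s01' t01']] := ar' v0 v1 isT; have [ok12' [s12' t12']] := ar' v1 v2 isT.
have h i j g : a_cell (sar x i j g) = a_cell (sar x' i j g).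
  exact: (congr1 (fun w : simplex (bicat_data B) 2 => sar w i j g) eq_F).
have tri := nerve_ok_triangle nx; have := nerve_ok_triangle nx'.
have <- : a_2 (sce x v0 v1 v2 isT isT) = a_2 (sce x' v0 v1 v2 isT isT).
  exact: (congr1 (fun w : simplex (bicat_data B) 2 => sce w v0 v1 v2 isT isT) eq_F).
move=> tri'; have t1 := etrans t01 (esym s12); have t1' := etrans t01' (esym s12').
have E01 : k != 2 -> sar x v0 v1 isT = sar x' v0 v1 isT.
  by rewrite eq_sym => k2; apply: (sar_face (eq_face v2 k2)).
have E02 : k != 1 -> sar x v0 v2 isT = sar x' v0 v2 isT.
  by rewrite eq_sym => k1; apply: (sar_face (eq_face v1 k1)).
have E12 : k != 0 -> sar x v1 v2 isT = sar x' v1 v2 isT.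
  by rewrite eq_sym => k0; apply: (sar_face (eq_face v0 k0)).
case: k le_k {eq_f eq_face} E01 E02 E12 => [|[|[|//]]] _ E01 E02 E12.
- have {E01 E02} [E01 E02] := (E01 isT, E02 isT).
  apply: nerve_act_triangle_ext => //; rewrite -E01 -E02 in tri'; rewrite -E01 in t1'.
  apply: (horn_unique12 ok01 ok12 ok12' t1 _ (h _ _ _) tri tri').
  exact: (etrans (esym t1) t1').
- have {E01 E12} [E01 E12] := (E01 isT, E12 isT).
  apply: nerve_act_triangle_ext => //; rewrite -E01 -E12 in tri'.
  exact: (horn_unique02 (h _ _ _) tri tri').
- have {E12 E02} [E12 E02] := (E12 isT, E02 isT).
  apply: nerve_act_triangle_ext => //; rewrite -E12 -E02 in tri'; rewrite -E12 in t1'.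
  apply: (horn_unique01 ok01 ok01' ok12 t1 _ (h _ _ _) tri tri').
  exact: (etrans t1 (esym t1')).
Qed.

Lemma nerve_act_horn2_exists k (y : nat -> simplex D 1) (z : simplex (bicat_data B) 2) :
  k <= 2 -> (forall i, i <= 2 -> i != k -> is_nerve_simplex (y i)) ->
  (forall i j, i < j -> j <= 2 -> i != k -> j != k -> face i (y j) = face j.-1 (y i)) ->
  is_nerve_simplex z -> (forall i, i <= 2 -> i != k -> face i z = nerve_map F (y i)) ->
  exists x : simplex D 2, is_nerve_simplex x /\
    (forall i, i <= 2 -> i != k -> face i x = y i) /\ nerve_map F x = z.
Proof.
move=> le_k nerve_y compat nz fz.
(* [c l] is the nondegenerate edge of the [l]-th given face. *)
pose c l := sar (y l) e0 e1 isT.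
have L00 : lift (inord 0 : 'I_3) e0 = v1 by apply: val_inj; rewrite /= inordK.
have L01 : lift (inord 0 : 'I_3) e1 = v2 by apply: val_inj; rewrite /= inordK.
have L10 : lift (inord 1 : 'I_3) e0 = v0 by apply: val_inj; rewrite /= inordK.
have L11 : lift (inord 1 : 'I_3) e1 = v2 by apply: val_inj; rewrite /= inordK.
have L20 : lift (inord 2 : 'I_3) e0 = v0 by apply: val_inj; rewrite /= inordK.
have L21 : lift (inord 2 : 'I_3) e1 = v1 by apply: val_inj; rewrite /= inordK.
have l0 : lift (inord 0 : 'I_2) ord0 = e1 by apply: val_inj; rewrite /= inordK.
have l1 : lift (inord 1 : 'I_2) ord0 = e0 by apply: val_inj; rewrite /= inordK.
have ok l : l <= 2 -> l != k ->
    [/\ ok1 (c l), a_src (c l) = sob (y l) e0 & a_tgt (c l) = sob (y l) e1].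
  by move=> ll lk; have [/(_ e0 e1 isT) [? [? ?]] _] := nerve_y l ll lk.
have zE l (i j : 'I_3) h : l <= 2 -> l != k -> lift (inord l) e0 = i -> lift (inord l) e1 = j ->
    a_cell (c l) = sar z i j h.
  move=> ll lk ei ej; have /(congr1 (fun w => sar w e0 e1 isT)) /= <- := fz l ll lk.
  exact: (@sar_irr (bicat_data B)).
have fx (x : simplex D 2) l (i j : 'I_3) h : is_nerve_simplex x -> l <= 2 -> l != k ->
    lift (inord l) e0 = i -> lift (inord l) e1 = j -> sar x i j h = c l -> face l x = y l.
  move=> nx ll lk ei ej xE; apply: nerve_act_edge_ext; first exact: nerve_precomp.
    exact: nerve_y.
  by rewrite -[RHS]xE /=; apply: (@sar_irr D).
have [ar [_ [/(_ v0 v1 v2 isT isT) [_ [dg [cg _]]] _]]] := nz.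
rewrite (@sar_irr (bicat_data B) 2 z v0 v2 v0 v2 _ isT) //= in cg; rewrite /= in dg.
have [_ [/= S01 T01]] := ar v0 v1 isT; have [_ [/= S12 T12]] := ar v1 v2 isT.
have [_ [/= S02 T02]] := ar v0 v2 isT.
(* It suffices to find three edges satisfying the triangle equation over the 2-cell of [z]; the last
   group leaves the edge opposite [k] free. *)
suff [c01 [c12 [c02 [[ok01 ok12 ok02] [h01 h12 h02] [s0 t1 tri] [E2 E0 E1]]]]] :
  exists c01 c12 c02, [/\ [/\ ok1 c01, ok1 c12 & ok1 c02],
    [/\ a_cell c01 = sar z v0 v1 isT, a_cell c12 = sar z v1 v2 isT & a_cell c02 = sar z v0 v2 isT],
    [/\ a_src c02 = a_src c01, a_tgt c01 = a_src c12 &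
        ok2 (Act2 (act_comp1 A c12 c01) c02 (sce z v0 v1 v2 isT isT))] &
    [/\ 2 != k -> c01 = c 2, 0 != k -> c12 = c 0 & 1 != k -> c02 = c 1]].
  have [x [nx x01 x12 x02 xz]] :=
    nerve_act_triangle nz ok01 ok12 ok02 h01 h12 h02 s0 tri t1.
  exists x; split=> //; split=> // -[|[|[|//]]] li lk.
  - by apply: (fx x 0 v1 v2 isT) => //; rewrite x12 E0.
  - by apply: (fx x 1 v0 v2 isT) => //; rewrite x02 E1.
  - by apply: (fx x 2 v0 v1 isT) => //; rewrite x01 E2.
have cz0 lk := zE 0 v1 v2 isT isT lk L00 L01; have cz1 lk := zE 1 v0 v2 isT isT lk L10 L11.
have cz2 lk := zE 2 v0 v1 isT isT lk L20 L21.
case: k le_k {nerve_y fz zE fx} compat ok cz0 cz1 cz2 => [|[|[|//]]] _ compat ok cz0 cz1 cz2.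
- have [[ok1_ s1 t1] [ok2_ s2 t2]] := (ok 1 isT isT, ok 2 isT isT).
  have {cz0 cz1 cz2} [C1 C2] := (cz1 isT, cz2 isT).
  (* Compatibility says that the two given edges share the vertex 0; in the next cases the shared
     vertex is 1, then 2. *)
  have := congr1 (fun w => sob w ord0) (compat 1 2 isT isT isT isT); rewrite /= l1 -s1 -s2 => s.
  have [[Ls1 [Lt1 _]] [Ls2 [Lt2 _]]] := (ok1_, ok2_).
  have [||||c12 [ok12 s12 h12 tri]] :=
    @horn_exists12 (c 2) (c 1) (sar z v1 v2 isT) (sce z v0 v1 v2 isT isT) ok2_ ok1_ s.
  + by rewrite Lt2 C2 T01 S12.
  + by rewrite Lt1 C1 T02 T12.
  + by rewrite C2.
  + by rewrite C1.
  by exists (c 2), c12, (c 1).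
- have [[ok0_ s0 t0] [ok2_ s2 t2]] := (ok 0 isT isT, ok 2 isT isT).
  have {cz0 cz1 cz2} [C0 C2] := (cz0 isT, cz2 isT).
  have := congr1 (fun w => sob w ord0) (compat 0 2 isT isT isT isT); rewrite /= l1 l0 -s0 -t2 => s.
  have [|c02 [h02 tri]] := @horn_exists02 (c 2) (c 0) (sce z v0 v1 v2 isT isT) ok2_ ok0_ s.
    by rewrite C0 C2.
  have [_ [ok02 [/= s02 _]]] := tri.
  by exists (c 2), (c 0), c02; split=> //; split=> //; rewrite h02.
- have [[ok0_ s0 t0] [ok1_ s1 t1]] := (ok 0 isT isT, ok 1 isT isT).
  have {cz0 cz1 cz2} [C0 C1] := (cz0 isT, cz1 isT).
  have := congr1 (fun w => sob w ord0) (compat 0 1 isT isT isT isT); rewrite /= l0 -t0 -t1 => s.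
  have [[Ls0 [Lt0 _]] [Ls1 [Lt1 _]]] := (ok0_, ok1_).
  have [||||c01 [ok01 t01 h01 tri]] :=
    @horn_exists01 (c 0) (c 1) (sar z v0 v1 isT) (sce z v0 v1 v2 isT isT) ok0_ ok1_ (esym s).
  + by rewrite Ls1 C1 S02 S01.
  + by rewrite Ls0 C0 S12 T01.
  + by rewrite C0.
  + by rewrite C1.
  have [_ [_ [/= s02 _]]] := tri.
  by exists c01, (c 0), (c 1).
Qed.

(** * The torsor conditions *)

Lemma nerve_act_exact_fibration m : exact_fibration_in_dim F m.
Proof.
case: m => [|m]; last exact: nerve_act_exact_fibration_ge3.
move=> k le_k; split=> [x x' | y ny compat z nz fz]; first exact: nerve_act_horn2_unique le_k.
exact: nerve_act_horn2_exists fz.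
Qed.

(** An edge is a morphism [q -> p <| h], and [pi] is constant both along morphisms and along the
    action. *)
Lemma nerve_act_augmented : @Augmented D X pi.
Proof.
move=> x [/(_ e0 e1 isT) [[/= _ [Lt [d c]]] [s t]] _]; rewrite /pi0 /=.
have -> : lift (inord 0 : 'I_2) ord0 = e1 by apply: val_inj; rewrite /= inordK.
have -> : lift (inord 1 : 'I_2) ord0 = e0 by apply: val_inj; rewrite /= inordK.
by rewrite -s -t /= -d -pi_cod c pi_act.
Qed.

Lemma nerve_act_aspherical : @Aspherical D X pi.
Proof.
split; [|split; last exact: nerve_act_boundary_surjective].
  move=> xi; have [p pp] := pi_surj xi.
  have [|x [nx [xo _]]] := @nerve_act_build_lt 0 (fun _ => p) (fun _ _ => act_id1 A p).
    by move=> i j; rewrite !ord1.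
  by exists x; split=> //; rewrite /pi0 xo.
move=> y0 y1 ny0 ny1 /act_ess_surj [q [f [a [b [Lq [da [ca [db cb]]]]]]]].
have Lp0 : mom A (sob y0 ord0) = btgt f by rewrite -ca mom_cod da.
have [da' ca'] : gdom (actM A a (bid2 f)) = actO A q f /\
                 gcod (actM A a (bid2 f)) = actO A (sob y0 ord0) f.
  by split; ty.
(* Face 0 is the target vertex, so the edge runs from [y1] to [y0]. Essential surjectivity supplies
   its morphism as the inverse of [b] followed by [a] acted on by [f]. *)
have [|x [nx x0 x1 _]] := @nerve_act_edge
  (Act1 (sob y1 ord0) (sob y0 ord0) (gcomp (actM A a (bid2 f)) (ginv b)) f).
  have Lp1 : mom A (sob y1 ord0) = bsrc f by rewrite -cb mom_cod db mom_act.
  by split=> //=; split=> //; split; ty.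
exists x; split=> //; split; apply: nerve_act_ext_lt => //; try exact: nerve_precomp;
  try by move=> [[|//] ?] [[|//] ?].
- move=> i; rewrite ord1 /= -[RHS]x1; congr (sob x _).
  by apply: val_inj; rewrite /= inordK.
- move=> i; rewrite ord1 /= -[RHS]x0; congr (sob x _).
  by apply: val_inj; rewrite /= inordK.
Qed.

Lemma nerve_act_torsor : DuskinGlenn2Torsor F pi.
Proof.
split; first exact: nerve_act_exact_fibration.
split; first exact: nerve_act_augmented.
split; first exact: nerve_act_aspherical.
by move=> m; split; [apply: nerve_act_boundary_injective|apply: nerve_act_boundary_surjective].
Qed.

End Actions.

Theorem theorem7p2 (B : Bicat) (P : Groupoid) (A : RightActionData P B)
  (X : Type) (pi : gOb P -> X) :
  IsBigroupoid B ->
  IsRight2Torsor A pi ->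
  DuskinGlenn2Torsor (ActionProjection A) pi.
Proof. exact: nerve_act_torsor. Qed.
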